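(* Let $\overline{M}$ be a smooth $(n+1)$-dimensional manifold with boundary $\partial M$ and interior $M$. (i) Let $\nabla$ be a special affine connection on $M$ which is projectively compact of order $\alpha>0$. Then $\nabla$ has volume asymptotics of order $(n+2)/\alpha$. Moreover, any non-zero section of $\mathcal{E}(\alpha)$ over $M$ which is parallel for $\nabla$ extends by $0$ to a defining density for the boundary $\partial M$. (ii) Suppose that $\overline{M}$ is endowed with a projective structure, and that $\sigma\in\Gamma(\mathcal{E}(\alpha))$ (with $\alpha>0$) is a defining density for $\partial M$. Then $\sigma$ is nowhere vanishing on $M$, hence is a scale for the restriction of the projective structure to $M$, and the affine connection $\nabla$ on $M$ determined by this scale is projectively compact of order $\alpha$.
   Context: All affine connections (linear connections on the tangent bundle) are torsion free; smooth means $C^\infty$. Projective equivalence: for a one-form $\Upsilon$, write $\hat\nabla=\nabla+\Upsilon$ for the connection $\hat\nabla_\xi\eta=\nabla_\xi\eta+\Upsilon(\xi)\eta+\Upsilon(\eta)\xi$. Connections so related are projectively equivalent; a projective structure is a projective equivalence class. A local defining function for $\partial M$ is a smooth function $\rho:U\to\mathbb{R}_{\ge 0}$ on an open subset $U\subset\overline{M}$ with $\rho^{-1}(\{0\})=U\cap\partial M$ and $d\rho$ nowhere vanishing on $U\cap\partial M$. Projective compactness of order $\alpha>0$: an affine connection $\nabla$ on $M$ is projectively compact of order $\alpha$ if every $x\in\partial M$ has a neighborhood $U$ in $\overline{M}$ with a defining function $\rho:U\to\mathbb{R}$ such that the connection $\hat\nabla=\nabla+\frac{d\rho}{\alpha\rho}$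 on $U\cap M$ extends smoothly to all of $U$. The projective structure of such a $\nabla$ extends (uniquely) to $\overline M$. Densities: for a manifold $N$ of dimension $n+1$, $\mathrm{vol}(N)$ is the (trivializable) line bundle of volume densities, and $\mathcal{E}(w)=\mathrm{vol}(N)^{-w/(n+2)}$, $w\in\mathbb{R}$, is the bundle of projective densities of weight $w$. Any affine connection induces connections on all these bundles. If $\hat\nabla=\nabla+\Upsilon$, then $\hat\nabla_\xi\sigma=\nabla_\xi\sigma+w\Upsilon(\xi)\sigma$ for $\sigma\in\Gamma(\mathcal{E}(w))$. For $w\ne 0$ and a nowhere vanishing section of $\mathcal{E}(w)$ (called a scale), there is a unique connection in a given projective class for which the section is parallel: the connection determined by the scale. An affine connection is special if it admits a non-zero (nowhere vanishing) parallel section of $\mathrm{vol}(N)$. Volume asymptotics of order $\beta$: a special affine connection $\nabla$ on $M$ has volume asymptotics of order $\beta$ if each $x_0\in\partial M$ has an open neighborhood $U$ in $\overline{M}$ with a local defining function $\rho$ for $\partial M$ and a nowhere vanishing section $\nu$ of $\mathrm{vol}(\overline{M})$ over $U$ such that $\rho^{-\beta}\nu|_{U\cap M}$ is parallel for $\nabla$. Defining density: a section $\sigma$ of a real power of $\mathrm{vol}(\overline{M})$ over $\overline M$ whose zero locus is $\partial M$ and such that, in some (equivalently any) local trivialization around points of $\partial M$, $\sigma$ is represented (up to sign) by a defining function for $\partial M$. *)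

(* Defs.v *)
From HB Require Import structures.
From mathcomp Require Import all_boot all_order all_algebra.
From mathcomp Require Import all_classical all_reals all_analysis.

Set Implicit Arguments.
Unset Strict Implicit.
Unset Printing Implicit Defensive.

Import Order.TTheory GRing.Theory Num.Theory.
Import numFieldNormedType.Exports.

Local Open Scope classical_set_scope.
Local Open Scope ring_scope.

Section Euclidean.
Variables (R : realType) (n : nat).
Notation E := 'rV[R]_n.+1.
Implicit Types (A O : set E) (f g : E -> R) (k : 'I_n.+1).

Definition ebase k : E := delta_mx 0 k.

Fixpoint Ck_on (m : nat) O f : Prop :=
  match m with
  | 0 => forall x, O x -> {for x, continuous f}
  | m'.+1 => (forall x, O x -> differentiable f x) /\
             (forall k, Ck_on m' O (fun x => 'D_(ebase k) f x))
  end.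

Definition Cinf_on O f : Prop := forall m, Ck_on m O f.

Definition half_space : set E := [set x | 0 <= x 0 ord0].

(* Smoothness on a set that need not be open: near each of its points the
   function is the restriction of a smooth function on an open set. *)
Definition smooth_on A f : Prop :=
  forall x, A x -> exists O g,
    [/\ open O, O x, Cinf_on O g & forall y, O y -> A y -> f y = g y].

(* The right-hand partial derivative.  Every direction [ebase k] points into
   [half_space] at every point of [half_space], so this makes sense up to the
   boundary; for a function smooth on a relatively open subset of [half_space]
   it is the partial derivative of any local smooth extension. *)
Definition rpartial k f (x : E) : R :=
  lim (h^-1 * (f (x + h *: ebase k) - f x) @[h --> 0^'+]).

End Euclidean.

(* A homeomorphism from an open subset of [T] onto a relatively open subset of
   the half-space.  The values of [chart_to] off [chart_dom], and those of
   [chart_from] off the image of [chart_dom], are irrelevant. *)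
Record chart (R : realType) (n : nat) (T : topologicalType) := Chart {
  chart_dom : set T;
  chart_to : T -> 'rV[R]_n.+1;
  chart_from : 'rV[R]_n.+1 -> T;
  chart_dom_open : open chart_dom;
  chart_toK : forall x, chart_dom x -> chart_from (chart_to x) = x;
  chart_image_open : exists2 O : set 'rV[R]_n.+1,
    open O & chart_to @` chart_dom = O `&` @half_space R n;
  chart_to_continuous : {within chart_dom, continuous chart_to};
  chart_from_continuous :
    {within chart_to @` chart_dom, continuous chart_from} }.

(* Smooth manifolds with boundary, of dimension n+1.  The smooth structure is
   given by an atlas, not assumed maximal; [chart_at] picks for each point a
   chart of the atlas around it. *)
Record bmanifold (R : realType) (n : nat) := BManifold {
  bm_space :> topologicalType;
  bm_hausdorff : hausdorff_space bm_space;
  bm_second_countable : @second_countable bm_space;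
  bm_index : Type;
  bm_chart : bm_index -> chart R n bm_space;
  bm_compatible : forall (i j : bm_index) (k : 'I_n.+1),
    smooth_on
      (chart_to (bm_chart i) @`
        (chart_dom (bm_chart i) `&` chart_dom (bm_chart j)))
      (fun y => chart_to (bm_chart j) (chart_from (bm_chart i) y) 0 k);
  chart_at : bm_space -> bm_index;
  chart_atP : forall x, chart_dom (bm_chart (chart_at x)) x }.

Section Manifold.
Variables (R : realType) (n : nat) (M : bmanifold R n).
Notation E := 'rV[R]_n.+1.

Definition cdom (i : bm_index M) : set M := chart_dom (bm_chart i).
Definition cto (i : bm_index M) : M -> E := chart_to (bm_chart i).
Definition cfrom (i : bm_index M) : E -> M := chart_from (bm_chart i).

Definition mboundary : set M :=
  [set x | exists2 i, cdom i x & cto i x 0 ord0 = 0].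
Definition minterior : set M := ~` mboundary.

Definition smooth_fun (V : set M) (f : M -> R) : Prop :=
  forall i, smooth_on (cto i @` (V `&` cdom i)) (f \o cfrom i).

(* The derivative of [f] at [x] along the [k]-th coordinate field of chart [i]. *)
Definition pd (i : bm_index M) (k : 'I_n.+1) (f : M -> R) (x : M) : R :=
  rpartial k (f \o cfrom i) (cto i x).

(* Row [a] consists of the derivatives along the [a]-th coordinate of chart [i]
   of the coordinates of chart [j]. *)
Definition jac (i j : bm_index M) (x : M) : 'M[R]_n.+1 :=
  \matrix_(a, b) pd i a (fun y => cto j y 0 b) x.

(* The tangent space at [x] is identified with R^(n+1) through the coordinate
   basis of the chart [chart_at x]; cotangent spaces (columns) and the fibres of
   the powers of vol (scalars) are trivialised by the same chart.  Since
   [chart_at] may jump from point to point, such a field is not smooth as a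
   function on [M]: smoothness is that of its representatives in the charts.
   Fields are total functions, and only their values on the open set under
   consideration matter. *)
Definition vfield : Type := M -> E.
Definition form : Type := M -> 'cV[R]_n.+1.
Definition density : Type := M -> R.

Definition vf_in (i : bm_index M) (X : vfield) (x : M) : E :=
  X x *m jac (chart_at x) i x.
Definition form_in (i : bm_index M) (U : form) (x : M) : 'cV[R]_n.+1 :=
  jac i (chart_at x) x *m U x.
(* The coefficient of [s], a section of vol^p, with respect to |dx_i|^p. *)
Definition dens_in (p : R) (i : bm_index M) (s : density) (x : M) : R :=
  s x * `|\det (jac i (chart_at x) x)| `^ p.

Definition smooth_vf (V : set M) (X : vfield) : Prop :=
  forall i k, smooth_fun (V `&` cdom i) (fun x => vf_in i X x 0 k).
Definition smooth_form (V : set M) (U : form) : Prop :=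
  forall i k, smooth_fun (V `&` cdom i) (fun x => form_in i U x k 0).
Definition smooth_dens (p : R) (V : set M) (s : density) : Prop :=
  forall i, smooth_fun (V `&` cdom i) (dens_in p i s).

Definition vf_app (X : vfield) (f : M -> R) (x : M) : R :=
  \sum_k X x 0 k * pd (chart_at x) k f x.
Definition form_app (U : form) (X : vfield) (x : M) : R := (X x *m U x) 0 0.
Definition dform (f : M -> R) : form := fun x => \col_k pd (chart_at x) k f x.

Definition bracket (X Y : vfield) : vfield := fun x =>
  \row_k (vf_app X (fun y => vf_in (chart_at x) Y y 0 k) x
          - vf_app Y (fun y => vf_in (chart_at x) X y 0 k) x).

(* The [k]-th coordinate vector field of chart [i] (meaningful on [cdom i]). *)
Definition frame (i : bm_index M) (k : 'I_n.+1) : vfield := fun x =>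
  row k (jac i (chart_at x) x).

(* A torsion-free linear connection on the tangent bundle of [W], as a covariant
   derivative acting on the vector fields over all open subsets of [W],
   compatibly with restriction. *)
Record affine_connection (W : set M) (D : vfield -> vfield -> vfield) : Prop :=
  AffineConnection {
  conn_smooth : forall V X Y, open V -> V `<=` W ->
    smooth_vf V X -> smooth_vf V Y -> smooth_vf V (D X Y);
  conn_local : forall V X X' Y Y', open V -> V `<=` W ->
    smooth_vf V X -> smooth_vf V X' -> smooth_vf V Y -> smooth_vf V Y' ->
    (forall x, V x -> X x = X' x) -> (forall x, V x -> Y x = Y' x) ->
    forall x, V x -> D X Y x = D X' Y' x;
  conn_addl : forall V X X' Y, open V -> V `<=` W ->
    smooth_vf V X -> smooth_vf V X' -> smooth_vf V Y ->
    forall x, V x -> D (fun y => X y + X' y) Y x = D X Y x + D X' Y x;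
  conn_scalel : forall V f X Y, open V -> V `<=` W ->
    smooth_fun V f -> smooth_vf V X -> smooth_vf V Y ->
    forall x, V x -> D (fun y => f y *: X y) Y x = f x *: D X Y x;
  conn_addr : forall V X Y Y', open V -> V `<=` W ->
    smooth_vf V X -> smooth_vf V Y -> smooth_vf V Y' ->
    forall x, V x -> D X (fun y => Y y + Y' y) x = D X Y x + D X Y' x;
  conn_leibniz : forall V f X Y, open V -> V `<=` W ->
    smooth_fun V f -> smooth_vf V X -> smooth_vf V Y ->
    forall x, V x ->
      D X (fun y => f y *: Y y) x = vf_app X f x *: Y x + f x *: D X Y x;
  conn_torsion_free : forall V X Y, open V -> V `<=` W ->
    smooth_vf V X -> smooth_vf V Y ->
    forall x, V x -> D X Y x - D Y X x = bracket X Y x }.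

Definition conn_eq (W : set M) (D D' : vfield -> vfield -> vfield) : Prop :=
  forall V X Y, open V -> V `<=` W -> smooth_vf V X -> smooth_vf V Y ->
  forall x, V x -> D X Y x = D' X Y x.

Definition conn_add (D : vfield -> vfield -> vfield) (U : form) :
    vfield -> vfield -> vfield :=
  fun X Y x => D X Y x + form_app U X x *: Y x + form_app U Y x *: X x.

Definition proj_equiv (W : set M) (D D' : vfield -> vfield -> vfield) : Prop :=
  exists2 U, smooth_form W U & conn_eq W D' (conn_add D U).

Definition proj_structure (W : set M)
    (P : set (vfield -> vfield -> vfield)) : Prop :=
  exists2 D0, affine_connection W D0 &
    P = [set D | affine_connection W D /\ proj_equiv W D0 D].

Definition proj_restrict (W : set M) (P : set (vfield -> vfield -> vfield)) :
    set (vfield -> vfield -> vfield) :=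
  [set D | affine_connection W D /\ exists2 D0, P D0 & proj_equiv W D0 D].

(* The connection induced on vol^p.  With F the coordinate frame of the chart at
   [x], the induced connection on vol is determined by
     (nabla_X nu)(F) = X(nu(F)) - sum_k nu(F_0, .., nabla_X F_k, .., F_n)
                     = X(nu(F)) - tr(nabla_X F) nu(F),
   and on vol^p the trace gets multiplied by [p]. *)
Definition dens_deriv (p : R) (D : vfield -> vfield -> vfield)
    (X : vfield) (s : density) (x : M) : R :=
  vf_app X (dens_in p (chart_at x) s) x
  - p * (\sum_k D X (frame (chart_at x) k) x 0 k) * s x.

Definition parallel_dens (p : R) (W : set M)
    (D : vfield -> vfield -> vfield) (s : density) : Prop :=
  forall V X, open V -> V `<=` W -> smooth_vf V X ->
  forall x, V x -> dens_deriv p D X s x = 0.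

Definition special_connection (W : set M)
    (D : vfield -> vfield -> vfield) : Prop :=
  exists nu, [/\ smooth_dens 1 W nu, forall x, W x -> nu x != 0 &
                 parallel_dens 1 W D nu].

(* The bundle E(w) of projective densities of weight w is vol^(eweight w). *)
Definition eweight (w : R) : R := - w / n.+2%:R.

Definition defining_fun (U : set M) (rho : M -> R) : Prop :=
  [/\ open U, smooth_fun U rho,
      forall x, U x -> 0 <= rho x,
      forall x, U x -> (rho x = 0 <-> mboundary x) &
      forall x, U x -> mboundary x -> dform rho x != 0].

Definition projectively_compact (alpha : R)
    (D : vfield -> vfield -> vfield) : Prop :=
  forall x, mboundary x -> exists U rho,
    [/\ U x, defining_fun U rho &
        exists2 D', affine_connection U D' &
          conn_eq (U `&` minterior) D'
            (conn_add D (fun y => (alpha * rho y)^-1 *: dform rho y))].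

Definition volume_asymptotics (beta : R)
    (D : vfield -> vfield -> vfield) : Prop :=
  forall x, mboundary x -> exists U rho nu,
    [/\ U x, defining_fun U rho,
        smooth_dens 1 U nu, forall y, U y -> nu y != 0 &
        parallel_dens 1 (U `&` minterior) D
          (fun y => rho y `^ (- beta) * nu y)].

(* [tau] is the section of vol^p that defines the local trivialisation. *)
Definition defining_density (p : R) (s : density) : Prop :=
  [/\ smooth_dens p setT s,
      forall x, s x = 0 <-> mboundary x &
      forall x, mboundary x -> exists U tau rho,
        [/\ U x, smooth_dens p U tau, forall y, U y -> tau y != 0,
            defining_fun U rho &
            (forall y, U y -> s y = rho y * tau y) \/
            (forall y, U y -> s y = - rho y * tau y)]].

Definition extend_by_0 (s : density) : density :=
  patch (fun=> 0) minterior s.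

(* [D] is a connection over the interior, in the restriction of the projective
   structure [P], for which the scale [s] of E(w) is parallel. *)
Definition scale_connection (P : set (vfield -> vfield -> vfield)) (w : R)
    (s : density) (D : vfield -> vfield -> vfield) : Prop :=
  proj_restrict minterior P D /\ parallel_dens (eweight w) minterior D s.

End Manifold.

Arguments mboundary {R n} M.
Arguments minterior {R n} M.

(* Main.v *)
(** On vol^p, passing from [nabla] to [nabla + Upsilon] subtracts
    [p (n+2) Upsilon] from the connection form.  Hence, if [s] is parallel for
    [nabla], the section [rho ^ (p (n+2) / alpha) s] is parallel for
    [nabla + drho / (alpha rho)].  The latter connection is smooth up to the
    boundary, and a parallel section of such a connection extends smoothly and
    without zeros across the boundary: along the inner normal coordinate it
    solves a linear ODE with coefficients smooth up to the boundary.  Taking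
    [p = 1] gives the volume asymptotics, and [p = - alpha / (n+2)], for which
    the exponent is -1, gives the defining density.

    Conversely, the connection of the projective class of [nabla0] determined by
    the scale [sigma] is [nabla0 - (nabla0 sigma / sigma) / alpha].  If
    [sigma = rho tau] with [tau] nowhere zero, the singular part of this one-form
    is exactly [- drho / (alpha rho)], so that adding [drho / (alpha rho)] leaves
    [nabla0 - (nabla0 tau / tau) / alpha], which is smooth up to the boundary. *)

Require Import Defs.
From HB Require Import structures.
From mathcomp Require Import all_boot all_order all_algebra.
From mathcomp Require Import all_classical all_reals all_analysis.
From mathcomp Require Import perm ring lra.

Set Implicit Arguments.
Unset Strict Implicit.
Unset Printing Implicit Defensive.

Import Order.TTheory GRing.Theory Num.Theory.
Import numFieldNormedType.Exports.

Local Open Scope classical_set_scope.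
Local Open Scope ring_scope.

(** * Functions of class C^k *)

Section Calculus.
Context {R : realType} {n : nat}.
Notation E := 'rV[R]_n.+1.
Notation e_ := (@ebase R n).
Implicit Types (O : set E) (f g : E -> R) (k : 'I_n.+1) (x z h : E).

(** No existence theorem for ODEs is used. Along the normal coordinate, parallelism of a density is
    a scalar linear equation in one variable, so its solution is an explicit exponential of a
    primitive. The dependence on the tangential coordinates comes from an interior slice, where the
    section is already smooth. Smoothness up to the boundary asks for an extension to an open set of
    R^(n+1), so the primitive must be smooth jointly in all coordinates, also at points outside the
    half-space; this is what differentiation under the integral sign is for. The second obstacle is
    that fibres are trivialised by [chart_at], which may jump. Every field is therefore read in one
    chart held fixed near a point. That the derivative of a density does not depend on this chart
    rests on Jacobi's formula: the logarithmic derivative of the Jacobian determinant cancels the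
    inhomogeneous term of the trace of the connection. The constant n+2 is the trace of eta |->
    Upsilon(xi) eta + Upsilon(eta) xi in dimension n+1, namely (n+1) Upsilon(xi) + Upsilon(xi). *)

Definition coord_form (c : 'I_n.+1 -> R) (h : E) : R := \sum_k h 0 k * c k.

Lemma coord_form_linear c : linear (coord_form c).
Proof.
move=> a u v; rewrite /coord_form scaler_sumr -big_split /=.
by apply: eq_bigr => k _; rewrite !mxE mulrDl -mulrA.
Qed.

HB.instance Definition _ c :=
  GRing.isLinear.Build R E R *:%R (coord_form c) (coord_form_linear c).

Lemma cvg_sumr (V : normedModType R) (T : Type) (F : set_system T)
    {FF : Filter F} (I : Type) (r : seq I) (f : I -> T -> V) (l : I -> V) :
  (forall i, f i x @[x --> F] --> l i) ->
  \sum_(i <- r) f i x @[x --> F] --> \sum_(i <- r) l i.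
Proof.
move=> fl; elim: r => [|i r IH].
  by under eq_fun do rewrite big_nil; rewrite big_nil; exact: cvg_cst.
under eq_fun do rewrite big_cons; rewrite big_cons; exact: cvgD.
Qed.

Lemma near_openP (T : topologicalType) (x : T) (P : T -> Prop) :
  (\near x, P x) -> exists U, [/\ open U, U x & forall y, U y -> P y].
Proof.
by move=> nP; have : nbhs x P := nP; rewrite nbhsE => -[U [oU Ux] UP]; exists U.
Qed.

Lemma near_gt0 (T : topologicalType) (u : T -> R) (x : T) :
  {for x, continuous u} -> 0 < u x -> \forall y \near x, 0 < u y.
Proof. by move=> cu u0; exact: (@cvgr_gt _ _ _ (nbhs_filter x) u (u x) cu). Qed.

Lemma coord_form_continuous c : continuous (coord_form c).
Proof.
move=> x; rewrite /continuous_at /coord_form.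
apply: (@cvg_sumr _ _ (nbhs x)) => k.
by apply: cvgMl; exact: coord_continuous.
Qed.

(** The estimate makes [coord_form c] the differential by [diff_unique], which asks for its
    continuity; evaluating on base vectors gives the partial derivatives. This epsilon form is what
    can be checked for an integral with parameters. *)
Lemma differentiable_littleo f x c :
  (forall e, 0 < e ->
     \forall h \near (0 : E), `|f (h + x) - f x - coord_form c h| <= e * `|h|) ->
  differentiable f x /\ forall k, 'D_(e_ k) f x = c k.
Proof.
move=> fo; have cc := @coord_form_continuous c.
have dE : 'd f x = coord_form c :> (E -> R).
  apply: (diff_unique cc); apply/eqaddoP => e /fo; apply: filterS => h.
  by rewrite !fctE /= opprD addrA.
have df : differentiable f x.
  apply/diff_locallyP; split; first by rewrite dE.
  apply/eqaddoP => e /fo; apply: filterS => h.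
  by rewrite !fctE /= dE opprD addrA.
split => // k; rewrite deriveE // dE /coord_form.
rewrite (bigD1 k) //= big1 ?addr0 /ebase ?mxE ?eqxx ?mul1r // => j /negPf jk.
by rewrite mxE jk andbF mul0r.
Qed.

Lemma row_ebase (x : E) : x = \sum_k x 0 k *: e_ k.
Proof. exact: row_sum_delta. Qed.

Lemma diffE_partial f x h : differentiable f x ->
  'd f x h = coord_form (fun k => 'D_(e_ k) f x) h.
Proof.
move=> df; rewrite [in LHS](row_ebase h) linear_sum; apply: eq_bigr => k _.
by rewrite linearZ /= deriveE.
Qed.

Lemma near_eq_differentiable f g x :
  (\near x, f x = g x) -> differentiable f x -> differentiable g x.
Proof.
move=> fg df; suff [//] : differentiable g x /\ forall k, 'D_(e_ k) g x = 'D_(e_ k) f x.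
apply: differentiable_littleo => e e0; have /diff_locally/eqaddoP/(_ e e0) := df.
move: (fg); rewrite (near_shift 0) => fg0; apply: filterS2 fg0 => h /=.
rewrite subr0 => <-; rewrite !fctE /= -diffE_partial // (nbhs_singleton fg).
by rewrite opprD addrA.
Qed.

Lemma rV_coord_le (u : E) j : `|u 0 j| <= `|u|.
Proof.
rewrite [leRHS]/Num.Def.normr/= mx_normrE.
exact: (le_bigmax _ (fun i : 'I_1 * 'I_n.+1 => `|u i.1 i.2|) (0, j)).
Qed.

Lemma rV_norm_le (u : E) e : 0 <= e -> (forall j, `|u 0 j| <= e) -> `|u| <= e.
Proof.
move=> e0 ue; rewrite [leLHS]/Num.Def.normr/= mx_normrE.
by apply: bigmax_le => //= -[i j] _; rewrite ord1.
Qed.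

Lemma differentiable_coord0 j (x : E) : differentiable (fun z : E => z 0 j) x.
Proof. exact: differentiable_coord. Qed.

Lemma derive_coord j (x v : E) : 'D_v (fun z : E => z 0 j) x = v 0 j.
Proof.
have := @derive_mx R E 1 n.+1 id x v (@derivable_id _ _ _ _).
by rewrite derive_id => /rowP/(_ j); rewrite mxE.
Qed.

Lemma coord_ebase k j : (e_ k) 0 j = (j == k)%:R.
Proof. by rewrite /ebase mxE eqxx. Qed.

Lemma differentiable_row (P : E -> E) x :
  (forall j, differentiable (fun z => P z 0 j) x) -> differentiable P x.
Proof.
move=> dP; have -> : P = \sum_(j < n.+1) (fun z => P z 0 j *: e_ j).
  by apply/funext => z; rewrite fct_sumE [LHS]row_ebase.
apply: differentiable_sum => j; exact: differentiableZl.
Qed.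

Lemma row_continuous (T : topologicalType) (P : T -> E) (x : T) :
  (forall j, {for x, continuous (fun y => P y 0 j)}) -> {for x, continuous P}.
Proof.
move=> cP; have PE : P = fun y => \sum_j P y 0 j *: e_ j.
  by apply/funext => y; exact: row_ebase.
rewrite PE; apply: (@cvg_sumr _ _ (nbhs x)) => j; apply: cvgZr_tmp.
exact: cP.
Qed.

Lemma diff_comp_row g (P : E -> E) x :
  differentiable g (P x) -> (forall j, differentiable (fun z => P z 0 j) x) ->
  differentiable (fun z => g (P z)) x /\
  forall v, 'D_v (fun z => g (P z)) x =
    \sum_j 'D_v (fun z => P z 0 j) x * 'D_(e_ j) g (P x).
Proof.
move=> dg dP; have dPx := differentiable_row dP.
have dgP : differentiable (g \o P) x by exact: differentiable_comp.
split => // v; rewrite [LHS](@deriveE _ _ _ (g \o P)) // diff_comp //=.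
rewrite diffE_partial // -deriveE // derive_mx; last exact: diff_derivable.
by apply: eq_bigr => j _; rewrite mxE.
Qed.

Lemma diff_comp1 (phi : R -> R) dphi f x :
  is_derive (f x) 1 phi dphi -> differentiable f x ->
  differentiable (fun z => phi (f z)) x /\
  forall v, 'D_v (fun z => phi (f z)) x = dphi * 'D_v f x.
Proof.
move=> [dp pE] df; have dp' := (derivable1_diffP _ _).1 dp.
have dgP : differentiable (phi \o f) x by exact: differentiable_comp.
split => // v; rewrite [LHS](@deriveE _ _ _ (phi \o f)) // diff_comp //=.
by rewrite deriv1E //= derive1E pE -deriveE // mulrC.
Qed.

Lemma is_derive_line f (z h : E) (t : R) : differentiable f (z + t *: h) ->
  is_derive t 1 (fun u => f (z + u *: h)) ('d f (z + t *: h) h).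
Proof.
move=> df.
have dl : is_diff t (cst z + ( *:%R ^~ h : R -> E)) (0 + *:%R ^~ h).
  exact: is_diffD.
have dc : differentiable (f \o (cst z + ( *:%R ^~ h : R -> E))) t.
  by apply: differentiable_comp.
apply: DeriveDef; first exact/derivable1_diffP.
rewrite (@deriveE _ _ _ (f \o (cst z + ( *:%R ^~ h : R -> E)))) // diff_comp //=.
by rewrite diff_val !fctE add0r scale1r.
Qed.

(** On the line through [z] in the direction [e_ k] the function has a minimum at parameter 0, and
    the one-variable theorem applies. Base vectors have norm at most 1, so parameters below [r] in
    absolute value stay in the ball. *)
Lemma derive_at_min (u : E -> R) O k z : open O ->
  (forall y, O y -> differentiable u y) -> O z ->
  (\forall y \near z, u z <= u y) -> 'D_(e_ k) u z = 0.
Proof.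
move=> oO du Oz umin.
have [r /= r0 rB] : exists2 r : R, 0 < r & forall y, ball z r y -> O y /\ u z <= u y.
  have : \forall y \near z, O y /\ u z <= u y.
    by apply: filterI => //; exact: open_nbhs_nbhs.
  by move=> nz; have /nbhs_ballP [r r0 rB] : nbhs z _ := nz; exists r.
have e1 : `|e_ k| <= 1.
  by apply: rV_norm_le => // j; rewrite coord_ebase normr_nat; case: (j == k).
have tb (t : R) : t \in `](- r), r[ -> ball z r (z + t *: e_ k).
  rewrite in_itv /= -ltr_norml => tr.
  rewrite -ball_normE /= opprD addNKr normrN normrZ.
  by apply: le_lt_trans tr; rewrite ler_piMr.
have dl (t : R) : t \in `](- r), r[ ->
    is_derive t 1 (fun s => u (z + s *: e_ k)) ('d u (z + t *: e_ k) (e_ k)).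
  by move=> /tb/rB[/du dt _]; exact: is_derive_line.
have i0 : (0 : R) \in `](- r), r[ by rewrite in_itv /= oppr_lt0 r0.
have rr : - r <= r by rewrite (@le_trans _ _ 0) ?oppr_le0 ?(ltW r0).
have dt (t : R) : t \in `](- r), r[ -> derivable (fun s : R => u (z + s *: e_ k)) t 1.
  by move=> /dl[].
have mt (t : R) : t \in `](- r), r[ -> u (z + (0 : R) *: e_ k) <= u (z + t *: e_ k).
  by move=> /tb/rB[_]; rewrite scale0r addr0.
have [_ D0] := derive1_at_min rr dt i0 mt.
have [_ D1] := dl 0 i0.
by move: D1; rewrite D0 scale0r addr0 -deriveE //; exact: du.
Qed.

(** * Closure properties of the classes C^k *)

Lemma eq_Ck_on m O f g : open O -> (forall x, O x -> f x = g x) ->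
  Ck_on m O f -> Ck_on m O g.
Proof.
move=> oO; have near_O x : O x -> \near x, O x by move=> Ox; exact: open_nbhs_nbhs.
elim: m f g => [|m IH] f g fg /=.
  move=> cf x Ox; have fx := cf x Ox.
  have -> : {for x, continuous g} = (g y @[y --> x] --> g x) by [].
  have fgn : \near x, f x = g x by apply: filterS (near_O x Ox) => y; exact: fg.
  rewrite -(fg x Ox); apply: cvg_trans fx; exact: (near_eq_cvg fgn).
case=> df Df; split => [x Ox|k].
  apply: near_eq_differentiable (df x Ox); near=> y; apply: fg.
  by near: y; exact: near_O.
apply: IH (Df k) => x Ox; apply: near_eq_derive; near=> y; apply: fg.
by near: y; exact: near_O.
Unshelve. all: by end_near. Qed.

Lemma Ck_on_sub m O O' f : O' `<=` O -> Ck_on m O f -> Ck_on m O' f.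
Proof.
move=> OO'; elim: m f => [|m IH] f /=; first by move=> cf x /OO'; exact: cf.
by case=> df Df; split => [x /OO'|k]; [exact: df|exact: IH].
Qed.

Lemma Ck_onS m O f : Ck_on m.+1 O f -> Ck_on m O f.
Proof.
elim: m f => [|m IH] f /= [df Df]; last by split => // k; exact: IH.
by move=> x Ox; apply: differentiable_continuous; exact: df.
Qed.

Lemma Ck_on0 m O f : Ck_on m O f -> Ck_on 0 O f.
Proof. by elim: m => // m IH /Ck_onS. Qed.

Lemma Ck_on_local m O f :
  (forall x, O x -> exists U : set E, U x /\ Ck_on m U f) -> Ck_on m O f.
Proof.
elim: m f => [|m IH] f /= loc; first by move=> x /loc [U [Ux]]; apply.
split => [x /loc [U [Ux [+ _]]]|k]; first by apply.
by apply: IH => x /loc [U [Ux [_ Df]]]; exists U; split.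
Qed.

Lemma Ck_on_cst m O (c : R) : Ck_on m O (fun=> c).
Proof.
elim: m c => [|m IH] c /=; first by move=> x _; exact: cst_continuous.
split => [x _|k]; first exact: differentiable_cst.
by have -> : 'D_(e_ k) (fun=> c) = (fun=> 0) :> (E -> R) by
  apply/funext => x; exact: derive_cst.
Qed.

Lemma Ck_on_add m O f g : open O ->
  Ck_on m O f -> Ck_on m O g -> Ck_on m O (fun x => f x + g x).
Proof.
move=> oO; elim: m f g => [|m IH] f g /=.
  by move=> cf cg x Ox; apply: continuousD; [exact: cf|exact: cg].
move=> [df Df] [dg Dg]; split => [x Ox|k].
  by apply: differentiableD; [exact: df|exact: dg].
apply: eq_Ck_on (IH _ _ (Df k) (Dg k)) => // x Ox.
by rewrite [RHS](@deriveD _ _ _ f g) //; apply/diff_derivable; auto.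
Qed.

Lemma Ck_on_mul m O f g : open O ->
  Ck_on m O f -> Ck_on m O g -> Ck_on m O (fun x => f x * g x).
Proof.
move=> oO; elim: m f g => [|m IH] f g.
  by move=> /= cf cg x Ox; apply: continuousM; [exact: cf|exact: cg].
move=> Cf Cg; have [/= df Df] := Cf; have [/= dg Dg] := Cg; split => [x Ox|k].
  by apply: differentiableM; [exact: df|exact: dg].
apply: eq_Ck_on (Ck_on_add oO (IH _ _ (Ck_onS Cf) (Dg k))
  (IH _ _ (Ck_onS Cg) (Df k))) => // x Ox.
by rewrite [RHS](@deriveM _ _ f g) //; apply/diff_derivable; auto.
Qed.

Lemma Ck_on_sum m O (I : Type) (r : seq I) (F : I -> E -> R) : open O ->
  (forall i, Ck_on m O (F i)) -> Ck_on m O (fun x => \sum_(i <- r) F i x).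
Proof.
move=> oO CF; elim: r => [|i r IH].
  by apply: eq_Ck_on (Ck_on_cst m O 0) => // x _; rewrite big_nil.
by apply: eq_Ck_on (Ck_on_add oO (CF i) IH) => // x _; rewrite big_cons.
Qed.

Lemma Ck_on_coord m O j : Ck_on m O (fun x => x 0 j).
Proof.
case: m => [|m] /=; first by move=> x _; exact: coord_continuous.
split => [x _|k]; first exact: differentiable_coord.
have -> : 'D_(e_ k) (fun x : E => x 0 j) = (fun=> (e_ k) 0 j) :> (E -> R).
  by apply/funext => x; exact: derive_coord.
exact: Ck_on_cst.
Qed.

(** The exponent stays general in the induction, since differentiation replaces [p] by [p - 1]. *)
Lemma Ck_on_powR m O f (p : R) : open O -> (forall x, O x -> 0 < f x) ->
  Ck_on m O f -> Ck_on m O (fun x => f x `^ p).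
Proof.
move=> oO f0; elim: m p => [|m IH] p Cf.
  move=> x Ox; apply: (@continuous_comp _ _ _ f (@powR R ^~ p)); first exact: Cf.
  apply/differentiable_continuous/derivable1_diffP.
  exact: (@ex_derive _ _ _ _ _ _ _ (is_derive1_powR p (f0 _ Ox))).
have [/= df Df] := Cf.
have dp x : O x -> _ := fun Ox => diff_comp1 (is_derive1_powR p (f0 x Ox)) (df x Ox).
split => [x /dp[]//|k].
have Cp := Ck_on_mul oO (Ck_on_cst m O p) (IH (p - 1) (Ck_onS Cf)).
apply: eq_Ck_on (Ck_on_mul oO Cp (Df k)) => // x Ox.
by rewrite (dp x Ox).2.
Qed.

Lemma Ck_on_expR m O f : open O -> Ck_on m O f -> Ck_on m O (fun x => expR (f x)).
Proof.
move=> oO; elim: m => [|m IH] Cf.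
  by move=> x Ox; apply: (@continuous_comp _ _ _ f expR);
    [exact: Cf|exact: continuous_expR].
have [/= df Df] := Cf.
have dp x : O x -> _ := fun Ox => diff_comp1 (is_derive_expR (f x)) (df x Ox).
split => [x /dp[]//|k].
apply: eq_Ck_on (Ck_on_mul oO (IH (Ck_onS Cf)) (Df k)) => // x Ox.
by rewrite (dp x Ox).2.
Qed.

(** By the chain rule the partial derivatives of the composite are sums of partial derivatives of
    [P] times composites of [P] with partial derivatives of [g]; the induction therefore varies [g]
    and keeps [P]. *)
Lemma Ck_on_comp m O O' g (P : E -> E) : open O ->
  (forall x, O x -> O' (P x)) -> (forall j, Ck_on m O (fun x => P x 0 j)) ->
  Ck_on m O' g -> Ck_on m O (fun x => g (P x)).
Proof.
move=> oO OP; elim: m g => [|m IH] g CP Cg.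
  move=> x Ox; apply: (@continuous_comp _ _ _ P g); last by apply: Cg; exact: OP.
  by apply: row_continuous => j; exact: CP.
have [/= dg Dg] := Cg.
have dP x : O x -> _ := fun Ox =>
  diff_comp_row (dg _ (OP _ Ox)) (fun j => (CP j).1 _ Ox).
split => [x /dP[]//|k].
have CS : Ck_on m O (fun x =>
    \sum_j 'D_(e_ k) (fun z => P z 0 j) x * 'D_(e_ j) g (P x)).
  apply: Ck_on_sum => // j; apply: Ck_on_mul => //; first exact: (CP j).2.
  by apply: (IH _ _ (Dg j)) => i; exact: Ck_onS.
by apply: eq_Ck_on CS => // x Ox; rewrite (dP x Ox).2.
Qed.

End Calculus.

(** * Primitives depending on parameters *)

Section Primitive.
Context {R : realType} {n : nat}.
Notation E := 'rV[R]_n.+1.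
Notation e_ := (@ebase R n).
Notation mu := (@lebesgue_measure R).
Implicit Types (O : set E) (f g : R -> R) (k : 'I_n.+1) (x z h : E).

Lemma continuous_at_dist (f : E -> R) z :
  (forall e : R, 0 < e -> \forall y \near z, `|f z - f y| <= e) ->
  {for z, continuous f}.
Proof. by move=> H; apply: (@cvgrPdist_le _ _ _ (nbhs z) (nbhs_filter z) f (f z)).2. Qed.

Definition int01 (f : R -> R) : R := (\int[mu]_(s in `[0%R, 1%R]) f s)%R.
(** Continuity is two-sided even at the endpoints, so that the limit lemmas for [nbhs s] apply
    without passing to a subspace; [cont2] below follows the same convention. *)
Definition cont01 (f : R -> R) := forall s : R, 0 <= s <= 1 -> {for s, continuous f}.

Lemma cont01_integrable f : cont01 f -> mu.-integrable `[0%R, 1%R] (EFin \o f).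
Proof.
move=> cf; apply: continuous_compact_integrable; first exact: segment_compact.
by apply: continuous_in_subspaceT => s; rewrite inE /= in_itv /=; exact: cf.
Qed.

Lemma eq_cont01 f g : f =1 g -> cont01 f -> cont01 g.
Proof. by move/funext => ->. Qed.

Lemma eq_int01 f g : (forall s : R, 0 <= s <= 1 -> f s = g s) -> int01 f = int01 g.
Proof. by move=> fg; apply: eq_Rintegral => s; rewrite inE /= in_itv /=; exact: fg. Qed.

Lemma int01B f g : cont01 f -> cont01 g -> int01 (fun s => f s - g s) = int01 f - int01 g.
Proof. by move=> cf cg; apply: RintegralB => //; exact: cont01_integrable. Qed.

Lemma int01D f g : cont01 f -> cont01 g -> int01 (fun s => f s + g s) = int01 f + int01 g.
Proof. by move=> cf cg; apply: RintegralD => //; exact: cont01_integrable. Qed.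

Lemma int01Z (c : R) f : cont01 f -> int01 (fun s => c * f s) = c * int01 f.
Proof. by move=> cf; apply: RintegralZl => //; exact: cont01_integrable. Qed.

Lemma int01_cst (c : R) : int01 (fun=> c) = c.
Proof.
rewrite /int01 Rintegral_cst //= lebesgue_measure_itv /= lte_fin ltr01 /=.
by rewrite subr0 mulr1.
Qed.

Lemma cont01_sum (I : Type) (r : seq I) (F : I -> R -> R) :
  (forall i, cont01 (F i)) -> cont01 (fun s => \sum_(i <- r) F i s).
Proof.
by move=> cF s s01; apply: (@cvg_sumr _ _ _ (nbhs s)) => i; exact: cF.
Qed.

Lemma int01_sum (I : Type) (r : seq I) (F : I -> R -> R) :
  (forall i, cont01 (F i)) ->
  int01 (fun s => \sum_(i <- r) F i s) = \sum_(i <- r) int01 (F i).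
Proof.
move=> cF; elim: r => [|i r IH].
  rewrite big_nil -[RHS](int01_cst 0); apply: eq_int01 => s _; exact: big_nil.
rewrite big_cons -IH -int01D //; last exact: cont01_sum.
by apply: eq_int01 => s _; exact: big_cons.
Qed.

Lemma int01_norm_le f (e : R) : cont01 f -> (forall s : R, 0 <= s <= 1 -> `|f s| <= e) ->
  `|int01 f| <= e.
Proof.
move=> cf fe; have nf : cont01 (fun s => `|f s|).
  by move=> s s01; apply: cvg_norm; exact: cf.
apply: (@le_trans _ _ (int01 (fun s => `|f s|))).
  by apply: le_normr_Rintegral => //; exact: cont01_integrable.
rewrite -[leRHS]int01_cst; apply: le_Rintegral => //.
- exact: (cont01_integrable nf).
- by apply: cont01_integrable => s _; exact: cst_continuous.
Qed.

Definition cont2 O (F : R -> E -> R) := forall (s : R) z, 0 <= s <= 1 -> O z ->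
  {for (s, z), continuous (fun p : R * E => F p.1 p.2)}.

Lemma cont2_cont01 O F z : cont2 O F -> O z -> cont01 (F^~ z).
Proof.
move=> cF Oz s s01.
apply: (@continuous_comp _ _ _ (fun t : R => (t, z)) (fun p : R * E => F p.1 p.2)).
  exact: (cvg_pair (@cvg_id _ (nbhs s)) (@cvg_cst _ z _ (nbhs s) _)).
exact: cF.
Qed.

(* Compactness of [0, 1] makes the continuity in the parameter uniform. *)
Lemma cont2_unif O F z (e : R) : cont2 O F -> O z -> 0 < e ->
  \forall y \near z, forall s : R, 0 <= s <= 1 -> `|F s y - F s z| <= e.
Proof.
move=> cF Oz e0.
have /compact_near_coveringP cov := @segment_compact R 0 1.
have H := cov E (nbhs z) (fun y s => `|F s y - F s z| <= e) (nbhs_filter z).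
suff : \forall y \near z, `[0%R, 1%R] `<=` (fun s => `|F s y - F s z| <= e).
  by apply: filterS => y sub s s01; apply: sub; rewrite /= in_itv.
apply: H => s; rewrite /= in_itv /= => s01.
have /cvgrPdist_lt/(_ (e / 2)) := cF s z s01 Oz.
rewrite divr_gt0 // => /(_ isT) [[A B] /= [As Bz] AB].
exists (A, B) => //= -[t y] /= [At By].
have h1 := AB (t, y) (conj At By).
have h2 := AB (t, z) (conj At (nbhs_singleton Bz)).
rewrite /= in h1 h2; rewrite (le_trans (ler_distD (F s z) _ _)) //.
rewrite (splitr e) lerD // ltW //; first by rewrite distrC.
Qed.

Lemma int01_continuous O F z : open O -> cont2 O F -> O z ->
  {for z, continuous (fun y => int01 (F^~ y))}.
Proof.
move=> oO cF Oz; apply: continuous_at_dist => e e0.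
have nO : \near z, O z by exact: open_nbhs_nbhs.
apply: filterS2 (cont2_unif cF Oz e0) nO => y unif Oy.
have cy := cont2_cont01 cF Oy; have cz := cont2_cont01 cF Oz.
rewrite -int01B //; apply: int01_norm_le.
  by move=> s s01; apply: continuousB; [exact: cz|exact: cy].
by move=> s s01; rewrite distrC; exact: unif.
Qed.

(** Differentiation under the integral sign. For each [s] the mean value theorem on the segment from
    [z] to [z + h] turns the error into a difference of partial derivatives at two points, and
    [cont2_unif] makes that difference small uniformly in [s]. *)
Lemma int01_differentiable O F (dF : 'I_n.+1 -> R -> E -> R) z :
  open O -> cont2 O F -> (forall k, cont2 O (dF k)) ->
  (forall (s : R) x, 0 <= s <= 1 -> O x -> differentiable (F s) x /\
     forall k, 'D_(e_ k) (F s) x = dF k s x) ->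
  O z -> differentiable (fun y => int01 (F^~ y)) z /\
     forall k, 'D_(e_ k) (fun y => int01 (F^~ y)) z = int01 ((dF k)^~ z).
Proof.
move=> oO cF cdF DF Oz; apply: differentiable_littleo => e e0.
have nO : \near z, O z by exact: open_nbhs_nbhs.
(* Each of the [n.+1] coordinates contributes at most this share times the norm of [h]. *)
have e0' : 0 < e / n.+1%:R by rewrite divr_gt0 // ltr0n.
have [r /= r0 rB] : exists2 r : R, 0 < r & forall y, ball z r y -> O y /\
    forall k (s : R), 0 <= s <= 1 -> `|dF k s y - dF k s z| <= e / n.+1%:R.
  suff /nbhs_ballP [r r0 rB] : \forall y \near z, O y /\
      forall k (s : R), 0 <= s <= 1 -> `|dF k s y - dF k s z| <= e / n.+1%:R.
    by exists r.
  apply: filterI => //.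
  apply: (@filter_forall E 'I_n.+1
    (fun k y => forall s : R, 0 <= s <= 1 -> `|dF k s y - dF k s z| <= e / n.+1%:R)
    (nbhs z) (nbhs_filter z)) => k.
  exact: cont2_unif (cdF k) Oz e0'.
have nh : \forall h \near (0 : E), `|h| < r.
  by apply/nbhs_ballP; exists r => // h; rewrite -ball_normE /= sub0r normrN.
apply: filterS nh => h hr.
have hball (t : R) : 0 <= t <= 1 -> ball z r (z + t *: h).
  move=> /andP[t0 t1]; rewrite -ball_normE /= opprD addNKr normrN normrZ ger0_norm //.
  by apply: le_lt_trans hr; rewrite ler_piMl.
have Oh : O (h + z).
  by have [] := rB (z + 1 *: h) (hball 1 _); rewrite ?ler01 ?lexx // scale1r addrC.
have cF1 := cont2_cont01 cF Oh; have cF2 := cont2_cont01 cF Oz.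
have cdF' k : cont01 (fun s => h 0 k * dF k s z).
  move=> s s01; apply: cvgMl_tmp; exact: (cont2_cont01 (cdF k) Oz).
have -> : coord_form (fun k => int01 ((dF k)^~ z)) h =
    int01 (fun s => coord_form (fun k => dF k s z) h).
  rewrite /coord_form int01_sum //; apply: eq_bigr => k _.
  by rewrite int01Z //; exact: cont2_cont01 (cdF k) Oz.
have csum : cont01 (fun s => coord_form (fun k => dF k s z) h) by exact: cont01_sum.
have cB : cont01 (fun s => F s (h + z) - F s z).
  by move=> s s01; apply: continuousB; [exact: cF1|exact: cF2].
rewrite -int01B // -int01B //; apply: int01_norm_le.
  by move=> s s01; apply: continuousB; [exact: cB|exact: csum].
move=> s s01.
have dl (t : R) : 0 <= t <= 1 -> is_derive t 1 (fun u => F s (z + u *: h))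
    (coord_form (fun k => dF k s (z + t *: h)) h).
  move=> t01; have [d D] := DF s _ s01 (rB _ (hball t t01)).1.
  apply: is_derive_eq; first exact: is_derive_line.
  by rewrite diffE_partial //; apply: eq_bigr => k _; rewrite D.
have [| |t t01] := @MVT_segment R (fun u => F s (z + u *: h))
  (fun t => coord_form (fun k => dF k s (z + t *: h)) h) 0 1 ler01.
- by move=> t; rewrite in_itv /= => /andP[t0 t1]; apply: dl; rewrite !ltW.
- apply: continuous_in_subspaceT => t; rewrite inE /= in_itv /= => t01.
  apply: differentiable_continuous; apply/derivable1_diffP.
  by have [] := dl t t01.
rewrite in_itv /= in t01.
rewrite scale1r scale0r addr0 subr0 mulr1 [h + z]addrC => ->.
rewrite /coord_form -sumrB (le_trans (ler_norm_sum _ _ _)) //.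
apply: (@le_trans _ _ (\sum_(k < n.+1) e / n.+1%:R * `|h|)).
  apply: ler_sum => k _; rewrite -mulrBr normrM mulrC ler_pM //.
    by have [_] := rB _ (hball t t01); apply.
  exact: rV_coord_le.
by rewrite sumr_const card_ord -mulrnAl -[_ *+ n.+1]mulr_natr divfK ?pnatr_eq0.
Qed.

Lemma int01_FTC f F : cont01 f ->
  (forall s : R, 0 <= s <= 1 -> is_derive s 1 F (f s)) -> int01 f = F 1 - F 0.
Proof.
move=> cf dF.
have cF (s : R) : 0 <= s <= 1 -> {for s, continuous F}.
  move=> s01; apply/differentiable_continuous/derivable1_diffP.
  by have [] := dF s s01.
rewrite /int01 /Rintegral (@continuous_FTC2 _ f F) //=.
- by apply: continuous_in_subspaceT => s; rewrite inE /= in_itv /=; exact: cf.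
- split.
  + by move=> s; rewrite in_itv /= => /andP[s0 s1]; have [|] := dF s; rewrite ?ltW.
  + by apply: cvg_at_right_filter; apply: cF; rewrite lexx ler01.
  + by apply: cvg_at_left_filter; apply: cF; rewrite lexx ler01.
- move=> s; rewrite in_itv /= => /andP[s0 s1]; rewrite derive1E.
  have s01 : 0 <= s <= 1 by rewrite !ltW.
  by have [_ ->] := dF s s01.
Qed.

(** The first coordinate becomes c + s (z_0 - c): as [s] goes from 0 to 1 the point runs along the
    normal segment from the hyperplane z_0 = c to [z]. *)
Definition shrink (c s : R) z : E := z - ((1 - s) * (z 0 ord0 - c)) *: e_ ord0.

Lemma shrink_coord c s z j :
  (shrink c s z) 0 j = z 0 j - (1 - s) * (z 0 ord0 - c) * (j == ord0)%:R.
Proof. by rewrite /shrink !mxE eqxx. Qed.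

(** With [c] the first coordinate of the centre, shrinking multiplies the distance to the centre in
    coordinate 0 by [s] and changes no other coordinate, which suffices for the sup norm. *)
Lemma ball_shrink z0 r s z : 0 <= s <= 1 -> ball z0 r z ->
  ball z0 r (shrink (z0 0 ord0) s z).
Proof.
move=> /andP[s0 s1]; rewrite -ball_normE /= => zr; apply: le_lt_trans zr.
apply: rV_norm_le => // j; apply: le_trans (rV_coord_le (z0 - z) j).
rewrite !mxE eqxx /=; have [->|_] := eqVneq j ord0; last by rewrite mulr0 subr0.
rewrite mulr1.
have -> : z0 0 ord0 - (z 0 ord0 - (1 - s) * (z 0 ord0 - z0 0 ord0)) =
  s * (z0 0 ord0 - z 0 ord0) by ring.
by rewrite normrM ger0_norm // ler_piMl.
Qed.

Lemma shrink_continuous c : continuous (fun p : R * E => shrink c p.1 p.2).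
Proof.
move=> [s z].
have c1 : (fun p : R * E => p.1) p @[p --> (s, z)] --> s by exact: cvg_fst.
have c2 : (fun p : R * E => p.2) p @[p --> (s, z)] --> z by exact: cvg_snd.
have c3 : (fun p : R * E => p.2 0 ord0) p @[p --> (s, z)] --> z 0 ord0.
  exact: (cvg_comp _ _ c2 (@coord_continuous R 1 n.+1 0 ord0 z)).
apply: cvgB => //; apply: cvgZr_tmp; apply: cvgM.
  by apply: cvgB => //; exact: cvg_cst.
by apply: cvgB => //; exact: cvg_cst.
Qed.

Lemma shrink_diff c s j x : differentiable (fun z => shrink c s z 0 j) x /\
  forall v : E, 'D_v (fun z => shrink c s z 0 j) x =
    v 0 j - (1 - s) * v 0 ord0 * (j == ord0)%:R.
Proof.
pose q : R := - ((1 - s) * (j == ord0)%:R).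
have -> : (fun z => shrink c s z 0 j) =
    (fun z : E => z 0 j) + (q *: (fun z : E => z 0 ord0)) + cst (- q * c).
  apply/funext => z; rewrite !fctE shrink_coord /q /GRing.scale /=; ring.
have d1 := @differentiable_coord0 R n j x.
have d2 := differentiableZ q (@differentiable_coord0 R n ord0 x).
have d12 := differentiableD d1 d2.
split; first by apply: differentiableD => //; exact: differentiable_cst.
move=> v; rewrite deriveD; [|exact: diff_derivable|exact: derivable_cst].
rewrite derive_cst addr0 deriveD; [|exact: diff_derivable..].
rewrite deriveZ; last by apply: diff_derivable; exact: differentiable_coord0.
by rewrite !derive_coord /q /GRing.scale /=; ring.
Qed.

(* Smoothness of the primitive [(z_0 - c) wavg c 1 a z] of [a] is proved by
   induction on the order, which the weight [w] makes possible: differentiating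
   in the direction 0 multiplies it by [s]. *)
Definition wavg (c : R) (w : R -> R) (a : E -> R) z : R :=
  int01 (fun s => w s * a (shrink c s z)).

Lemma cont2_wavg z0 r (w : R -> R) (a : E -> R) : continuous w -> Ck_on 0 (ball z0 r) a ->
  cont2 (ball z0 r) (fun s z => w s * a (shrink (z0 0 ord0) s z)).
Proof.
move=> cw ca s z s01 Bz.
have c1 : (fun p : R * E => w p.1) p @[p --> (s, z)] --> w s.
  exact: (cvg_comp _ _ (@cvg_fst _ _ (nbhs s) (nbhs z) _) (cw s)).
apply: (cvgM c1).
apply: (@continuous_comp _ _ _ (fun p : R * E => shrink (z0 0 ord0) p.1 p.2) a).
  exact: shrink_continuous.
by apply: ca; exact: ball_shrink.
Qed.

Lemma wavg_diff z0 r (w : R -> R) (a : E -> R) z : continuous w -> Ck_on 1 (ball z0 r) a ->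
  ball z0 r z ->
  differentiable (wavg (z0 0 ord0) w a) z /\ forall k,
  'D_(e_ k) (wavg (z0 0 ord0) w a) z =
    wavg (z0 0 ord0) (fun s => w s * (if k == ord0 then s else 1)) ('D_(e_ k) a) z.
Proof.
move=> cw Ca Bz; have [/= da cda] := Ca.
have cwk k : continuous (fun s : R => w s * (if k == ord0 then s else 1)).
  move=> s; apply: cvgM; first exact: cw.
  by case: ifP => _; [exact: cvg_id|exact: cvg_cst].
apply: (@int01_differentiable (ball z0 r)
  (fun s z => w s * a (shrink (z0 0 ord0) s z))
  (fun k s z => w s * (if k == ord0 then s else 1) *
     'D_(e_ k) a (shrink (z0 0 ord0) s z)) z) => //.
- exact: ball_open.
- exact: (cont2_wavg cw (Ck_onS Ca)).
- move=> k; exact: (cont2_wavg (cwk k) (cda k)).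
move=> s x s01 Bx; set c := z0 0 ord0.
have dax := da _ (ball_shrink s01 Bx).
have [d D] := diff_comp_row dax (fun j => (shrink_diff c s j x).1).
split => [|k]; first exact: (differentiableZ (w s) d).
rewrite [LHS](@deriveZ _ _ _ _ (w s)); last exact: diff_derivable.
rewrite /GRing.scale /= D -mulrA; congr (_ * _).
rewrite (bigD1 k) //= big1 ?addr0 => [|j jk]; rewrite (shrink_diff c s _ x).2.
  rewrite !coord_ebase eqxx [ord0 == k]eq_sym; case: ifP => _ /=; congr (_ * _); ring.
rewrite !coord_ebase (negPf jk) [ord0 == k]eq_sym.
have [k0|] := eqVneq k ord0; last by rewrite mulr0 mul0r subr0 mul0r.
by rewrite -k0 (negPf jk) mulr0 subr0 mul0r.
Qed.

Lemma Ck_on_wavg m z0 r (w : R -> R) (a : E -> R) : continuous w -> Ck_on m (ball z0 r) a ->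
  Ck_on m (ball z0 r) (wavg (z0 0 ord0) w a).
Proof.
elim: m w a => [|m IH] w a cw Ca.
  move=> z Bz; apply: (int01_continuous _ (cont2_wavg cw Ca) Bz).
  exact: ball_open.
have C1 : Ck_on 1 (ball z0 r) a.
  by have [d Da] := Ca; split => // k; exact: Ck_on0 (Da k).
split => [z Bz|k]; first exact: (wavg_diff cw C1 Bz).1.
apply: eq_Ck_on (IH _ _ _ (Ca.2 k)); first exact: ball_open.
  by move=> z Bz; rewrite (wavg_diff cw C1 Bz).2.
move=> s; apply: cvgM; first exact: cw.
by case: ifP => _; [exact: cvg_id|exact: cvg_cst].
Qed.

(** The substitution t = c + s (z_0 - c) writes the primitive from [c] to z_0 as z_0 - c times an
    average over a fixed interval, so only the integrand depends on [z]. *)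
Lemma Cinf_primitive z0 r (a : E -> R) : Cinf_on (ball z0 r) a ->
  exists G : E -> R, Cinf_on (ball z0 r) G /\
    forall z, ball z0 r z -> 'D_(e_ ord0) G z = a z.
Proof.
move=> Ca; pose c := z0 0 ord0.
have c1 : continuous ((fun=> 1) : R -> R) by move=> x; exact: cvg_cst.
have oB : open (ball z0 r) by exact: ball_open.
pose G z := (z 0 ord0 + - c) * wavg c (fun=> 1) a z.
exists G; split => [m|z Bz].
  apply: Ck_on_mul => //; last exact: Ck_on_wavg.
  by apply: Ck_on_add => //; [exact: Ck_on_coord|exact: Ck_on_cst].
have [dw Dw] := wavg_diff c1 (Ca 1%N) Bz.
have dl : differentiable (fun z : E => z 0 ord0 + - c) z.
  by apply: differentiableD; [exact: differentiable_coord0|exact: differentiable_cst].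
rewrite [LHS](@deriveM _ _ (fun z : E => z 0 ord0 + - c)); [|exact: diff_derivable..].
rewrite Dw eqxx [X in _ + X](_ : _ = wavg c (fun=> 1) a z); last first.
  rewrite [X in _ *: X](@deriveD _ _ _ (fun z : E => z 0 ord0) (cst (- c)));
    [|by apply: diff_derivable; exact: differentiable_coord0|exact: derivable_cst].
  by rewrite derive_coord derive_cst coord_ebase eqxx addr0 /GRing.scale /= mulr1.
(* The product rule for [G] yields the integral of [f]. This is the [s]-derivative of s a(shrink c s
   z), which goes from 0 at s = 0 to a(z) at s = 1. *)
pose f s := a (shrink c s z) + s * ((z 0 ord0 - c) * 'D_(e_ ord0) a (shrink c s z)).
have ca : cont01 (fun s => a (shrink c s z)).
  apply: eq_cont01 (cont2_cont01 (cont2_wavg c1 (Ca 0%N)) Bz) => s.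
  exact: mul1r.
have cda : cont01 (fun s => s * 'D_(e_ ord0) a (shrink c s z)).
  have [_ D] := Ca 1%N.
  have cid : continuous ((fun s => s) : R -> R) by move=> s; exact: cvg_id.
  exact: (cont2_cont01 (cont2_wavg cid (D ord0 : Ck_on 0 (ball z0 r) _)) Bz).
have cda' : cont01 (fun s => (z 0 ord0 - c) * (s * 'D_(e_ ord0) a (shrink c s z))).
  by move=> s s01; apply: cvgMl_tmp; exact: cda.
have cf : cont01 f.
  apply: (@eq_cont01 (fun s => a (shrink c s z) +
    (z 0 ord0 - c) * (s * 'D_(e_ ord0) a (shrink c s z)))) => [s|s s01].
    by rewrite /f mulrCA.
  by apply: continuousD; [exact: ca|exact: cda'].
transitivity (int01 f); last first.
  suff dF (s : R) : 0 <= s <= 1 ->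
      is_derive s 1 (fun s => s * a (shrink c s z)) (f s).
    rewrite (int01_FTC cf dF).
    by rewrite mul0r subr0 mul1r /shrink subrr mul0r scale0r subr0.
  move=> s01.
  (* The path is a straight line in its parameter, the form that [is_derive_line] expects. *)
  have sE t : shrink c t z = shrink c 0 z + t *: ((z 0 ord0 - c) *: e_ ord0).
    by apply/rowP => j; rewrite /shrink !mxE eqxx /=; ring.
  have da : differentiable a (shrink c 0 z + s *: ((z 0 ord0 - c) *: e_ ord0)).
    by rewrite -sE; apply: (Ca 1%N).1; exact: ball_shrink.
  have -> : (fun s => s * a (shrink c s z)) =
     (id : R -> R) * (fun t : R => a (shrink c 0 z + t *: ((z 0 ord0 - c) *: e_ ord0))).
    by apply/funext => t; rewrite fctE /= -sE.
  apply: (is_derive_eq (is_deriveM (is_derive_id s 1) (is_derive_line da))).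
  rewrite diffE_partial // linearZ /= -diffE_partial // -deriveE // -sE.
  by rewrite /f /GRing.scale /= mulr1 addrC.
have -> : wavg c (fun=> 1) a z = int01 (fun s => a (shrink c s z)).
  by apply: eq_int01 => s _; exact: mul1r.
have -> : wavg (z0 0 ord0) (fun s => 1 * s) ('D_(e_ ord0) a) z =
    int01 (fun s => s * 'D_(e_ ord0) a (shrink c s z)).
  by apply: eq_int01 => s _; rewrite mul1r.
rewrite /GRing.scale /= -int01Z // addrC -int01D //.
by apply: eq_int01 => s _; rewrite /f mulrCA.
Qed.

Lemma convex_comb_gt0 (t a b : R) : 0 <= t <= 1 -> 0 < a -> 0 < b ->
  0 < (1 - t) * a + t * b.
Proof.
move=> /andP[t0 t1] a0 b0; have [->|tn0] := eqVneq t 0.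
  by rewrite subr0 mul1r mul0r addr0.
by rewrite ltr_wpDl ?mulr_ge0 ?subr_ge0 ?(ltW a0) // mulr_gt0 // lt_neqAle eq_sym tn0.
Qed.

Lemma eq_along_segment (f : E -> R) z h :
  (forall t : R, 0 <= t <= 1 ->
     differentiable f (z + t *: h) /\ 'd f (z + t *: h) h = 0) ->
  f (z + h) = f z.
Proof.
move=> df.
have dl (t : R) : 0 <= t <= 1 -> is_derive t 1 (fun u => f (z + u *: h)) 0.
  by move=> /df [d <-]; exact: is_derive_line.
have [| |t t01] := @MVT_segment R (fun u => f (z + u *: h)) (fun=> 0) 0 1 ler01.
- by move=> t; rewrite in_itv /= => /andP[t0 t1]; apply: dl; rewrite !ltW.
- apply: continuous_in_subspaceT => t; rewrite inE /= in_itv /= => t01.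
  apply: differentiable_continuous; apply/derivable1_diffP.
  by have [] := dl t t01.
by rewrite scale1r scale0r addr0 mul0r => /subr0_eq.
Qed.

Definition set_coord0 (b : R) z : E := z + (b - z 0 ord0) *: e_ ord0.

Lemma set_coord0E b z j :
  set_coord0 b z 0 j = if j == ord0 then b else z 0 j.
Proof.
rewrite /set_coord0 !mxE eqxx /=; case: eqP => [->|_]; last by rewrite mulr0 addr0.
by rewrite mulr1 addrC subrK.
Qed.

(** A ball of the sup norm is a box, so coordinate 0 may be reset to any value admissible for that
    coordinate, whatever the others are. *)
Lemma ball_set_coord0 z0 (r b : R) z : ball z0 r z -> `|z0 0 ord0 - b| < r ->
  ball z0 r (set_coord0 b z).
Proof.
rewrite -ball_normE /= => zr br.
apply: (@le_lt_trans _ _ (Num.max `|z0 - z| `|z0 0 ord0 - b|)); last first.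
  by rewrite gt_max zr.
apply: rV_norm_le => [|j]; first by rewrite le_max normr_ge0.
rewrite le_max mxE [X in _ + X]mxE set_coord0E; case: eqP => [->|_].
  by rewrite lexx orbT.
by have := rV_coord_le (z0 - z) j; rewrite !mxE => ->.
Qed.

(* The solution is [f z = f z' exp (G z - G z')] with [G] a primitive of [a] in
   the normal direction and [z'] the point of a fixed interior slice with the
   same tangential coordinates; this formula makes sense across the boundary. *)
Lemma Cinf_extend z0 (r : R) (f a : E -> R) : z0 0 ord0 = 0 -> 0 < r ->
  let B := ball z0 r in let Bp := B `&` [set z : E | 0 < z 0 ord0] in
  Cinf_on B a -> Cinf_on Bp f -> (forall z, Bp z -> f z != 0) ->
  (forall z, Bp z -> 'D_(e_ ord0) f z = a z * f z) ->
  exists g : E -> R, [/\ Cinf_on B g, forall z, B z -> g z != 0 &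
    forall z, Bp z -> g z = f z].
Proof.
move=> z00 r0 B Bp Ca Cf f0 Df; have [G [CG DG]] := Cinf_primitive Ca.
have oB : open B by exact: ball_open.
have oBp : open Bp.
  apply: openI => //; apply: (@open_comp _ _ (fun z : E => z 0 ord0) [set t | 0 < t]).
    by move=> z _; exact: coord_continuous.
  exact: open_gt.
(* The interior slice is z_0 = r/2: since the centre has first coordinate 0, it meets the ball
   inside the open half-space. *)
have r2 : 0 < r / 2 by rewrite divr_gt0.
have Lp b z : B z -> 0 < b -> b < r -> Bp (set_coord0 b z).
  move=> Bz b0 br; split; last by rewrite /= set_coord0E eqxx.
  by apply: ball_set_coord0 => //; rewrite z00 sub0r normrN gtr0_norm.
have r2r : r / 2 < r by rewrite ltr_pdivrMr // ltr_pMr // ltr1n.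
have LB z : B z -> Bp (set_coord0 (r / 2) z) by move=> Bz; exact: Lp.
have CL m j : Ck_on m B (fun z => set_coord0 (r / 2) z 0 j).
  apply: (@eq_Ck_on _ _ m B (fun z => if j == ord0 then r / 2 else z 0 j)) => //.
    by move=> z _; rewrite set_coord0E.
  by case: (j == ord0); [exact: Ck_on_cst|exact: Ck_on_coord].
pose g z := f (set_coord0 (r / 2) z) *
   expR (G z + (-1) * G (set_coord0 (r / 2) z)).
exists g; split => [m|z Bz|z Bpz].
- apply: Ck_on_mul => //; first by apply: (Ck_on_comp oB LB).
  apply: Ck_on_expR => //; apply: Ck_on_add => //.
  apply: Ck_on_mul => //; first exact: Ck_on_cst.
  apply: (@Ck_on_comp _ _ m B B) => // z /LB[]//.
- rewrite mulf_neq0 //; first by apply: f0; exact: LB.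
  by rewrite gt_eqF // expR_gt0.
(* Multiplying by the integrating factor makes the normal derivative (a f - f a) exp(-G) = 0, so [u]
   agrees at [z] and at its projection to the slice. *)
pose u x := f x * expR (-1 * G x).
have [Bz z0p] := Bpz.
have zr : z 0 ord0 < r.
  have := Bz; rewrite /B -ball_normE /= => zr.
  apply: le_lt_trans (ler_norm _) _; apply: le_lt_trans zr.
  by have := rV_coord_le (z0 - z) ord0; rewrite !mxE z00 sub0r normrN.
have uE : u (set_coord0 (r / 2) z) = u z.
  apply: eq_along_segment => t /andP[t0 t1].
  have tp : Bp (z + t *: ((r / 2 - z 0 ord0) *: e_ ord0)).
    have -> : z + t *: ((r / 2 - z 0 ord0) *: e_ ord0) =
      set_coord0 ((1 - t) * z 0 ord0 + t * (r / 2)) z.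
      by rewrite /set_coord0 scalerA; congr (_ + _ *: _); ring.
    have t01 : 0 <= t <= 1 by rewrite t0.
    apply: Lp => //; first exact: convex_comb_gt0.
    (* The segment from [z] to the slice stays in the half ball: its first coordinate lies between
       two numbers of ]0, r[. *)
    rewrite -subr_gt0 (_ : _ - _ = (1 - t) * (r - z 0 ord0) + t * (r - r / 2)).
      by apply: convex_comb_gt0 => //; rewrite subr_gt0.
    by ring.
  have dG : differentiable G (z + t *: ((r / 2 - z 0 ord0) *: e_ ord0)).
    by have [d _] := CG 1%N; apply: d; exact: tp.1.
  have df : differentiable f (z + t *: ((r / 2 - z 0 ord0) *: e_ ord0)).
    by have [d _] := Cf 1%N; exact: d.
  have dmG := differentiableZ (-1) dG.
  have [de De] := diff_comp1 (is_derive_expR _) dmG.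
  have du : differentiable u (z + t *: ((r / 2 - z 0 ord0) *: e_ ord0)).
    exact: differentiableM.
  split => //; rewrite linearZ /= -deriveE //.
  rewrite [X in _ *: X](@deriveM _ _ f (fun x => expR (-1 * G x))); [|exact: diff_derivable..].
  rewrite De (deriveZ (-1)); last exact: diff_derivable.
  rewrite Df // DG; last exact: tp.1.
  by rewrite /GRing.scale /=; ring.
rewrite /g expRD mulrCA -/(u _) uE /u mulrCA -expRD mulN1r addrN expR0 mulr1 //.
Qed.

End Primitive.

(** * Smooth functions in charts *)

Section Charts.
Context {R : realType} {n : nat} {M : bmanifold R n}.
Notation E := 'rV[R]_n.+1.
Notation e_ := (@ebase R n).
Implicit Types (i j : bm_index M) (k : 'I_n.+1) (x y : M) (f g : M -> R).

Lemma cdom_open i : open (cdom i).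
Proof. exact: chart_dom_open. Qed.

Lemma near_cdom i x : cdom i x -> \near x, cdom i x.
Proof. by move=> ix; apply: open_nbhs_nbhs; split => //; exact: cdom_open. Qed.

Lemma ctoK i x : cdom i x -> cfrom i (cto i x) = x.
Proof. exact: chart_toK. Qed.

Lemma cto_half i x : cdom i x -> 0 <= cto i x 0 ord0.
Proof.
move=> ix; have [ O _ imO] := chart_image_open (bm_chart i).
have : (cto i @` cdom i) (cto i x) by exists x.
by rewrite /cto /cdom imO => -[].
Qed.

Lemma cto_continuous i x : cdom i x -> {for x, continuous (cto i)}.
Proof.
move=> ix; have := @chart_to_continuous R n M (bm_chart i).
rewrite continuous_open_subspace; last exact: cdom_open.
by apply; rewrite inE.
Qed.

Lemma near_cto i x (P : E -> Prop) : cdom i x ->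
  (\forall z \near cto i x, P z) -> \forall y \near x, P (cto i y).
Proof. by move=> ix; exact: (cto_continuous ix). Qed.

(** Near a boundary point only the part of a neighbourhood in the half-space belongs to the image of
    the chart, hence the premise on [z]; the continuity of [chart_from] is relative to that
    image. *)
Lemma near_cfrom i x (P : M -> Prop) : cdom i x -> (\near x, P x) ->
  \forall z \near cto i x, half_space z ->
    [/\ cdom i (cfrom i z), P (cfrom i z) & cto i (cfrom i z) = z].
Proof.
move=> ix Px; have [ O oO imO] := chart_image_open (bm_chart i).
have imx : (cto i @` cdom i) (cto i x) by exists x.
have Ox : O (cto i x) by move: imx; rewrite /cto /cdom imO => -[].
have /subspace_continuousP/(_ _ imx) := @chart_from_continuous R n M (bm_chart i).
move=> cf0.
have cf : cfrom i z @[z --> within (cto i @` cdom i) (nbhs (cto i x))] --> x.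
  by rewrite -[X in _ --> X](ctoK ix); exact: cf0.
have nO : \forall z \near cto i x, O z by exact: open_nbhs_nbhs.
have nP : \forall z \near cto i x, (cto i @` cdom i) z -> P (cfrom i z).
  exact: cf Px.
apply: filterS2 nO nP => z Oz Pz hz.
have imz : (cto i @` cdom i) z by rewrite /cto /cdom imO; split.
by have Pcz := Pz imz; have [y iy yz] := imz; rewrite -yz ctoK //; split => //;
  rewrite -(ctoK iy) yz.
Qed.

(** The germ form of [smooth_on]: the extension [g] lives on an open set of [E], but agreement is
    required on the manifold side, so the half-space no longer appears. *)
Definition smooth_in i f x : Prop := exists O (g : E -> R),
  [/\ open O, O (cto i x), Cinf_on O g & \forall y \near x, f y = g (cto i y)].

Lemma smooth_on_in i V f x : open V -> V x -> cdom i x ->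
  smooth_on (cto i @` (V `&` cdom i)) (f \o cfrom i) -> smooth_in i f x.
Proof.
move=> oV Vx ix /(_ (cto i x)) [|O [g [oO Ox Cg fg]]]; first by exists x.
exists O, g; split => //.
have nV : \near x, V x by exact: open_nbhs_nbhs.
have nO : \forall y \near x, O (cto i y).
  by apply: near_cto => //; exact: open_nbhs_nbhs.
apply: filterS3 nV nO (near_cdom ix) => y Vy Oy iy.
by rewrite -fg //= ?ctoK //; exists y.
Qed.

Lemma smooth_in_on i V f :
  (forall x, V x -> cdom i x -> smooth_in i f x) ->
  smooth_on (cto i @` (V `&` cdom i)) (f \o cfrom i).
Proof.
move=> sf _ [x [Vx ix] <-]; have [ O [g [oO Ox Cg fg]]] := sf x Vx ix.
have [U [oU Ux Uf]] := near_openP (near_cfrom ix fg).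
exists (O `&` U), g; split => //; first exact: openI.
- by move=> m; apply: Ck_on_sub (Cg m) => z [].
- move=> z [Oz Uz] [y [Vy iy] yz].
  have [|_] := Uf z Uz; first by rewrite -yz; exact: cto_half.
  by move=> /= -> ->.
Qed.

Lemma smooth_funP V f : open V ->
  smooth_fun V f <-> forall i x, V x -> cdom i x -> smooth_in i f x.
Proof.
move=> oV; split => [sf i x Vx ix|sf i]; first exact: smooth_on_in (sf i).
by apply: smooth_in_on => x; exact: sf.
Qed.

Lemma smooth_in_row i x (h : 'I_n.+1 -> M -> R) : cdom i x ->
  (forall k, smooth_in i (h k) x) -> exists O (P : E -> E),
  [/\ open O, O (cto i x), forall k, Cinf_on O (fun z => P z 0 k) &
      \forall y \near x, forall k, h k y = P (cto i y) 0 k].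
Proof.
move=> ix sh.
have /choice[Og Hog] : forall k, exists Og : set E * (E -> R),
  [/\ open Og.1, Og.1 (cto i x), Cinf_on Og.1 Og.2 &
      \forall y \near x, h k y = Og.2 (cto i y)].
  by move=> k; have [ O [g H]] := sh k; exists (O, g).
have nO : \forall z \near cto i x, forall k, (Og k).1 z.
  apply: (@filter_forall E 'I_n.+1 (fun k z => (Og k).1 z) (nbhs (cto i x))) => k.
  by have [oO Ox _ _] := Hog k; exact: open_nbhs_nbhs.
have [ O [oO Ox OO]] := near_openP nO.
exists O, (fun z => \row_k (Og k).2 z); split => //.
- move=> k m; have [_ _ Cg _] := Hog k.
  apply: eq_Ck_on (Ck_on_sub _ (Cg m)) => // [z _|z Oz]; first by rewrite mxE.
  exact: OO.
- have H k : \forall y \near x, h k y = (Og k).2 (cto i y) by have [] := Hog k.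
  have := @filter_forall M 'I_n.+1 (fun k y => h k y = (Og k).2 (cto i y))
    (nbhs x) (nbhs_filter x) H.
  by apply: filterS => y Hy k; rewrite mxE.
Qed.

Lemma smooth_in_coord i j k x : cdom i x -> cdom j x ->
  smooth_in i (fun y => cto j y 0 k) x.
Proof.
move=> ix jx; apply: (@smooth_on_in i (cdom j)) => //; first exact: cdom_open.
by rewrite setIC; exact: bm_compatible.
Qed.

Lemma smooth_in_comp i x (h : 'I_n.+1 -> M -> R) O (g : E -> R) :
  cdom i x -> open O -> Cinf_on O g -> O (\row_k h k x) ->
  (forall k, smooth_in i (h k) x) ->
  smooth_in i (fun y => g (\row_k h k y)) x.
Proof.
move=> ix oO Cg Ox /(smooth_in_row ix) [U [P [oU Ux CP hP]]].
have hE y : (forall k, h k y = P (cto i y) 0 k) -> \row_k h k y = P (cto i y).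
  by move=> H; apply/rowP => k; rewrite mxE.
have nO : \forall z \near cto i x, U z /\ O (P z).
  apply: filterI; first exact: open_nbhs_nbhs.
  have cP : {for cto i x, continuous P}.
    by apply: row_continuous => k; exact: CP 0%N _ Ux.
  apply: cP; apply: open_nbhs_nbhs; split => //.
  by rewrite -hE //; exact: nbhs_singleton hP.
have [W [oW Wx WO]] := near_openP nO.
exists W, (fun z => g (P z)); split => //.
- move=> m; apply: (@Ck_on_comp _ _ m W O) => //.
  + by move=> z /WO[].
  + by move=> k; apply: Ck_on_sub (CP k m) => z /WO[].
- by apply: filterS hP => y /hE ->.
Qed.

(** Read in chart [j], the coordinates of chart [i] are smooth by [bm_compatible], and the local
    extension of [f] is composed with an extension of that transition map. *)
Lemma smooth_in_change i j f x : cdom i x -> cdom j x ->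
  smooth_in i f x -> smooth_in j f x.
Proof.
move=> ix jx [ O [g [oO Ox Cg fg]]].
have := @smooth_in_comp j x (fun k y => cto i y 0 k) O g jx oO Cg.
have rE y : \row_k cto i y 0 k = cto i y by apply/rowP => k; rewrite mxE.
rewrite rE => /(_ Ox (fun k => smooth_in_coord k jx ix)) [U [u [oU Uu Cu uE]]].
exists U, u; split => //; apply: filterS2 fg uE => y -> <-.
by rewrite rE.
Qed.

Definition smooth_at f x := smooth_in (chart_at x) f x.

Lemma smooth_at_in i f x : cdom i x -> smooth_at f x <-> smooth_in i f x.
Proof.
by move=> ix; split; apply: smooth_in_change => //; exact: (chart_atP x).
Qed.

Lemma smooth_fun_at V f : open V ->
  smooth_fun V f <-> forall x, V x -> smooth_at f x.
Proof.
move=> oV; rewrite smooth_funP //; split => [sf x Vx|sf i x Vx ix].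
  by apply: sf => //; exact: (chart_atP x).
by apply/smooth_at_in => //; exact: sf.
Qed.

Lemma smooth_at_near f g x : (\near x, f x = g x) -> smooth_at f x -> smooth_at g x.
Proof.
move=> fg [ O [u [oO Ox Cu fu]]]; exists O, u; split => //.
by apply: filterS2 fg fu => y ->.
Qed.

Lemma smooth_at_nbhs f x : smooth_at f x -> \near x, smooth_at f x.
Proof.
have cx := chart_atP x => -[ O [u [oO Ox Cu fu]]].
have nO : \forall y \near x, O (cto (chart_at x) y).
  by apply: near_cto => //; exact: open_nbhs_nbhs.
apply: filterS3 nO (near_cdom cx) (nbhs_interior fu) => y Oy cy fuy.
by apply/(smooth_at_in _ cy); exists O, u.
Qed.

(** * Operations on smooth germs *)

Lemma smooth_at_cst (c : R) x : smooth_at (fun=> c) x.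
Proof.
exists setT, (fun=> c); split => //; first exact: openT.
- by move=> m; exact: Ck_on_cst.
- exact: nearW.
Qed.

Lemma smooth_at_coord i k x : cdom i x -> smooth_at (fun y => cto i y 0 k) x.
Proof. by move=> ix; exact: (smooth_in_coord k (chart_atP x)). Qed.

Lemma smooth_at_op2 (op : R -> R -> R) f g x :
  (forall m O (u v : E -> R), open O -> Ck_on m O u -> Ck_on m O v ->
    Ck_on m O (fun z => op (u z) (v z))) ->
  smooth_at f x -> smooth_at g x -> smooth_at (fun y => op (f y) (g y)) x.
Proof.
move=> Cop [ O [u [oO Ox Cu fu]]] [U [v [oU Ux Cv gv]]].
exists (O `&` U), (fun z => op (u z) (v z)); split => //; first exact: openI.
- by move=> m; apply: Cop; [exact: openI|apply: Ck_on_sub (Cu m) => z []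
    |apply: Ck_on_sub (Cv m) => z []].
- by apply: filterS2 fu gv => y -> ->.
Qed.

Lemma smooth_at_add f g x :
  smooth_at f x -> smooth_at g x -> smooth_at (fun y => f y + g y) x.
Proof. by apply: smooth_at_op2 => m O u v; exact: Ck_on_add. Qed.

Lemma smooth_at_mul f g x :
  smooth_at f x -> smooth_at g x -> smooth_at (fun y => f y * g y) x.
Proof. by apply: smooth_at_op2 => m O u v; exact: Ck_on_mul. Qed.

Lemma smooth_at_opp f x : smooth_at f x -> smooth_at (fun y => - f y) x.
Proof.
move=> sf; apply: smooth_at_near (smooth_at_mul (smooth_at_cst (-1) x) sf).
by apply: nearW => y; rewrite mulN1r.
Qed.

Lemma smooth_at_sum (I : Type) (r : seq I) (F : I -> M -> R) x :
  (forall a, smooth_at (F a) x) -> smooth_at (fun y => \sum_(a <- r) F a y) x.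
Proof.
move=> sF; elim: r => [|a r IH].
  by apply: smooth_at_near (smooth_at_cst 0 x); apply: nearW => y; rewrite big_nil.
apply: smooth_at_near (smooth_at_add (sF a) IH).
by apply: nearW => y; rewrite big_cons.
Qed.

Lemma smooth_at_prod (I : Type) (r : seq I) (F : I -> M -> R) x :
  (forall a, smooth_at (F a) x) -> smooth_at (fun y => \prod_(a <- r) F a y) x.
Proof.
move=> sF; elim: r => [|a r IH].
  by apply: smooth_at_near (smooth_at_cst 1 x); apply: nearW => y; rewrite big_nil.
apply: smooth_at_near (smooth_at_mul (sF a) IH).
by apply: nearW => y; rewrite big_cons.
Qed.

Lemma smooth_at_continuous f x : smooth_at f x -> {for x, continuous f}.
Proof.
have cx := chart_atP x => -[ O [u [oO Ox Cu fu]]].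
have cu : u (cto (chart_at x) y) @[y --> x] --> u (cto (chart_at x) x).
  apply: (@cvg_comp _ _ _ (cto (chart_at x)) u); first exact: cto_continuous.
  exact: Cu 0%N _ Ox.
have -> : {for x, continuous f} = (f y @[y --> x] --> f x) by [].
rewrite (nbhs_singleton fu); apply: cvg_trans cu.
by apply: near_eq_cvg; apply: filterS fu => y ->.
Qed.

Lemma smooth_at_powR (p : R) f x : 0 < f x ->
  smooth_at f x -> smooth_at (fun y => f y `^ p) x.
Proof.
move=> fx [ O [u [oO Ox Cu fu]]].
have ux : 0 < u (cto (chart_at x) x) by rewrite -(nbhs_singleton fu).
have nO : \forall z \near cto (chart_at x) x, O z /\ 0 < u z.
  apply: filterI; first exact: open_nbhs_nbhs.
  exact: (near_gt0 (Cu 0%N _ Ox) ux).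
have [W [oW Wx WO]] := near_openP nO.
exists W, (fun z => u z `^ p); split => //; last by apply: filterS fu => y ->.
by move=> m; apply: Ck_on_powR => // [z /WO[]//|]; apply: Ck_on_sub (Cu m) => z /WO[].
Qed.

(** For positive increments z + h e_k stays in the half-space, where [F] and its extension agree,
    and the two-sided derivative of the extension restricts to a right derivative. *)
Lemma rpartialE (F g : E -> R) k z : differentiable g z -> half_space z ->
  (\forall z \near z, half_space z -> F z = g z) -> rpartial k F z = 'D_(e_ k) g z.
Proof.
move=> dg hz Fg; apply: cvg_lim => //.
have dgk : h^-1 *: (g (h *: e_ k + z) - g z) @[h --> 0^'] --> 'D_(e_ k) g z.
  have /cvg_ex[l dl] := diff_derivable dg (v := e_ k).
  by have -> : 'D_(e_ k) g z = l by exact: cvg_lim.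
have dgr : h^-1 *: (g (h *: e_ k + z) - g z) @[h --> 0^'+] --> 'D_(e_ k) g z.
  exact: cvg_dnbhs_at_right dgk.
have cl : z + h *: e_ k @[h --> 0^'+] --> z.
  rewrite -[X in _ --> X]addr0 -(scale0r (e_ k)); apply: cvgD; first exact: cvg_cst.
  by apply: cvgZr_tmp; apply: cvg_at_right_filter; exact: cvg_id.
have nF : \forall h \near (0 : R)^'+, half_space (z + h *: e_ k) ->
    F (z + h *: e_ k) = g (z + h *: e_ k) := cl _ Fg.
have h0 : \forall h \near (0 : R)^'+, 0 < h by exact: nbhs_right_gt.
suff H : \forall h \near (0 : R)^'+, h^-1 *: (g (h *: e_ k + z) - g z) =
    h^-1 * (F (z + h *: e_ k) - F z).
  by apply: cvg_trans dgr; exact: (near_eq_cvg H).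
apply: filterS2 nF h0 => h Fh h0.
have hh : half_space (z + h *: e_ k).
  by rewrite /half_space /= !mxE addr_ge0 // mulr_ge0 ?(ltW h0) // ler0n.
by rewrite (Fh hh) (nbhs_singleton Fg hz) [_ *: _ + z]addrC.
Qed.

Lemma pdE i k f (g : E -> R) x : cdom i x -> differentiable g (cto i x) ->
  (\forall y \near x, f y = g (cto i y)) -> pd i k f x = 'D_(e_ k) g (cto i x).
Proof.
move=> ix dg fg; apply: rpartialE => //; first exact: cto_half.
apply: filterS (near_cfrom ix fg) => z H hz.
by have [_ /= -> ->] := H hz.
Qed.

(** A single extension represents the values and all [pd] at every nearby point, including boundary
    points; the rules for [pd] then reduce to calculus on open sets of [E]. *)
Lemma smooth_at_rep i f x : cdom i x -> smooth_at f x ->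
  exists O (g : E -> R), [/\ open O, Cinf_on O g, O (cto i x) &
    \forall y \near x, [/\ cdom i y, O (cto i y), f y = g (cto i y) &
      forall k, pd i k f y = 'D_(e_ k) g (cto i y)]].
Proof.
move=> ix /(smooth_at_in _ ix) [ O [g [oO Ox Cg fg]]].
exists O, g; split => //.
have nO : \forall y \near x, O (cto i y).
  by apply: near_cto => //; exact: open_nbhs_nbhs.
apply: filterS3 nO (near_cdom ix) (nbhs_interior fg) => y Oy iy fy; split => //.
  exact: nbhs_singleton fy.
by move=> k; apply: pdE => //; have [dg _] := Cg 1%N; exact: dg.
Qed.

Lemma smooth_at_pd i k f x : cdom i x -> smooth_at f x -> smooth_at (pd i k f) x.
Proof.
move=> ix /(smooth_at_rep ix) [ O [g [oO Cg Ox fg]]].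
apply/(smooth_at_in _ ix); exists O, ('D_(e_ k) g); split => //.
  by move=> m; have [_ Dg] := Cg m.+1; exact: Dg.
by apply: filterS fg => y [].
Qed.

Lemma pd_near i k f g x : cdom i x -> smooth_at f x -> (\near x, f x = g x) ->
  pd i k f x = pd i k g x.
Proof.
move=> ix /(smooth_at_rep ix) [ O [u [oO Cu Ox fu]]] fg.
have [_ _ _ ->] := nbhs_singleton fu.
apply/esym/pdE => //; first by have [du _] := Cu 1%N; exact: du.
by apply: filterS2 fu fg => y [_ _ -> _] ->.
Qed.

(** * Rules for partial derivatives in a chart *)

Lemma pd_cst i k (c : R) x : cdom i x -> pd i k (fun=> c) x = 0.
Proof.
move=> ix; rewrite (@pdE i k _ (fun=> c)) //; first exact: derive_cst.
exact: nearW.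
Qed.

Lemma pd_add i k f g x : cdom i x -> smooth_at f x -> smooth_at g x ->
  pd i k (fun y => f y + g y) x = pd i k f x + pd i k g x.
Proof.
move=> ix /(smooth_at_rep ix) [ O [u [oO Cu Ox fu]]].
move=> /(smooth_at_rep ix) [U [v [oU Cv Ux gv]]].
have [_ _ _ ->] := nbhs_singleton fu; have [_ _ _ ->] := nbhs_singleton gv.
have du : differentiable u (cto i x) by have [du _] := Cu 1%N; exact: du.
have dv : differentiable v (cto i x) by have [dv _] := Cv 1%N; exact: dv.
rewrite (@pdE i k _ (u + v)) //; first by rewrite deriveD //; exact: diff_derivable.
- exact: differentiableD.
- by apply: filterS2 fu gv => y [_ _ -> _] [_ _ -> _].
Qed.

Lemma pd_mul i k f g x : cdom i x -> smooth_at f x -> smooth_at g x ->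
  pd i k (fun y => f y * g y) x = f x * pd i k g x + g x * pd i k f x.
Proof.
move=> ix /(smooth_at_rep ix) [ O [u [oO Cu Ox fu]]].
move=> /(smooth_at_rep ix) [U [v [oU Cv Ux gv]]].
have [_ _ -> ->] := nbhs_singleton fu; have [_ _ -> ->] := nbhs_singleton gv.
have du : differentiable u (cto i x) by have [du _] := Cu 1%N; exact: du.
have dv : differentiable v (cto i x) by have [dv _] := Cv 1%N; exact: dv.
rewrite (@pdE i k _ (u * v)) //; first by rewrite deriveM //; exact: diff_derivable.
- exact: differentiableM.
- by apply: filterS2 fu gv => y [_ _ -> _] [_ _ -> _].
Qed.

Lemma pd_powR i k (p : R) f x : cdom i x -> 0 < f x -> smooth_at f x ->
  pd i k (fun y => f y `^ p) x = p * f x `^ (p - 1) * pd i k f x.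
Proof.
move=> ix fx /(smooth_at_rep ix) [ O [u [oO Cu Ox fu]]].
have [_ _ fE ->] := nbhs_singleton fu; rewrite fE in fx *.
have du : differentiable u (cto i x) by have [du _] := Cu 1%N; exact: du.
have [d D] := diff_comp1 (is_derive1_powR p fx) du.
rewrite (@pdE i k _ (fun z => u z `^ p)) //.
by apply: filterS fu => y [_ _ -> _].
Qed.

Lemma pd_chain i j k f x : cdom i x -> cdom j x -> smooth_at f x ->
  pd i k f x = \sum_b jac i j x k b * pd j b f x.
Proof.
move=> ix jx /(smooth_at_rep jx) [ O [u [oO Cu Ox fu]]].
have [U [P [oU Ux CP hP]]] := smooth_in_row ix (fun k => smooth_in_coord k ix jx).
have cP y : (forall k, cto j y 0 k = P (cto i y) 0 k) -> cto j y = P (cto i y).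
  by move=> H; apply/rowP => b.
have cPx := cP x (nbhs_singleton hP).
have du : differentiable u (P (cto i x)).
  by rewrite -cPx; have [du _] := Cu 1%N; exact: du.
have dP b : differentiable (fun z => P z 0 b) (cto i x).
  by have [d _] := CP b 1%N; exact: d.
have [d D] := diff_comp_row du dP.
rewrite (@pdE i k _ (fun z => u (P z))) //; last first.
  by apply: filterS2 fu hP => y [_ _ -> _] /cP ->.
rewrite D; apply: eq_bigr => b _; rewrite mxE; congr (_ * _).
  by apply/esym/pdE => //; apply: filterS hP => y ->.
by have [_ _ _ ->] := nbhs_singleton fu; rewrite cPx.
Qed.

(** * Jacobians of chart changes and invariance of the boundary *)

Lemma jac_cocycle i j l x : cdom i x -> cdom j x -> cdom l x ->
  jac i l x = jac i j x *m jac j l x.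
Proof.
move=> ix jx lx; apply/matrixP => a b; rewrite !mxE (@pd_chain i j) //.
  by apply: eq_bigr => c _; congr (_ * _); rewrite mxE.
exact: smooth_at_coord.
Qed.

Lemma jac_id i x : cdom i x -> jac i i x = 1%:M.
Proof.
move=> ix; apply/matrixP => a b; rewrite !mxE (@pdE i a _ (fun z => z 0 b)) //.
- by rewrite derive_coord coord_ebase eq_sym.
- exact: differentiable_coord0.
- exact: nearW.
Qed.

Lemma jacK i j x : cdom i x -> cdom j x -> jac i j x *m jac j i x = 1%:M.
Proof. by move=> ix jx; rewrite -jac_cocycle // jac_id. Qed.

Lemma det_jac_neq0 i j x : cdom i x -> cdom j x -> \det (jac i j x) != 0.
Proof.
move=> ix jx; apply/eqP => d0; have := det_mulmx (jac i j x) (jac j i x).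
by rewrite jacK // det1 d0 mul0r => /eqP; rewrite oner_eq0.
Qed.

Lemma pd_interior_min i k f x : cdom i x -> 0 < cto i x 0 ord0 -> smooth_at f x ->
  (\forall y \near x, f x <= f y) -> pd i k f x = 0.
Proof.
move=> ix x0 /(smooth_at_rep ix) [ O [u [oO Cu Ox fu]]] fmin.
have [_ _ fx ->] := nbhs_singleton fu.
(* As the first coordinate is positive at the point, a whole neighbourhood in [E] comes from the
   manifold, so the minimum is one of [u] on an open set. *)
have nu : \forall z \near cto i x, u (cto i x) <= u z.
  have nP : \forall y \near x, f x <= f y /\ f y = u (cto i y).
    by apply: filterS2 fmin fu => y ? [].
  have pos : \forall z \near cto i x, 0 < (z : E) 0 ord0.
    exact: (near_gt0 (@coord_continuous R 1 n.+1 0 ord0 (cto i x))).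
  apply: filterS2 pos (near_cfrom ix nP) => z z0 H.
  have [_ [le1 E1] cz] := H (ltW z0).
  by rewrite -fx -{1}cz -E1.
by apply: (derive_at_min _ oO) nu => // z Oz; have [du _] := Cu 1%N; exact: du.
Qed.

(* Were [x] an interior point for chart [j], the first coordinate of chart [i]
   would attain there its minimum 0, which kills a column of a Jacobian. *)
Lemma boundary_chart i j x : cdom i x -> cdom j x ->
  cto i x 0 ord0 = 0 -> cto j x 0 ord0 = 0.
Proof.
move=> ix jx x0; have := cto_half jx; rewrite le_eqVlt => /predU1P[//|xj].
have col0 b : jac j i x b ord0 = 0.
  rewrite mxE; apply: pd_interior_min => //; first exact: smooth_at_coord.
  by rewrite x0; apply: filterS (near_cdom ix) => y; exact: cto_half.
have /matrixP/(_ ord0 ord0) := jacK ix jx.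
rewrite !mxE eqxx big1 => [/eqP|b _]; last by rewrite col0 mulr0.
by rewrite eq_sym oner_eq0.
Qed.

Lemma mboundaryE i x : cdom i x -> mboundary M x <-> cto i x 0 ord0 = 0.
Proof.
by move=> ix; split => [[j jx x0]|x0]; [exact: boundary_chart x0|exists i].
Qed.

Lemma minteriorE i x : cdom i x -> minterior M x <-> 0 < cto i x 0 ord0.
Proof.
move=> ix; rewrite /minterior /setC /= (mboundaryE ix) lt_neqAle cto_half // andbT eq_sym.
by split => [/eqP|/eqP].
Qed.

Lemma minterior_open : open (minterior M).
Proof.
rewrite openE => x /(minteriorE (chart_atP x)) x0.
have := near_gt0 (smooth_at_continuous (smooth_at_coord ord0 (chart_atP x))) x0.
apply: filterS2 (near_cdom (chart_atP x)) => y yx y0.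
by apply/(minteriorE yx).
Qed.

End Charts.

(** * Vector fields, forms and densities *)

Section Tensors.
Context {R : realType} {n : nat} {M : bmanifold R n}.
Notation E := 'rV[R]_n.+1.
Notation e_ := (@ebase R n).
Implicit Types (i j : bm_index M) (k : 'I_n.+1) (x y : M) (f g : M -> R)
  (X Y Z : vfield M) (U : Defs.form M) (s : density M).

(** This trades the absolute value for a square, so that real powers of nonzero functions of either
    sign reduce to powers of positive smooth functions. *)
Lemma norm_powR_sqr (d p : R) : `|d| `^ p = (d * d) `^ (p / 2).
Proof.
have -> : d * d = `|d| `^ 2%:R by rewrite powR_mulrn // -expr2 real_normK ?num_real.
by rewrite -powRrM mulrC divfK // pnatr_eq0.
Qed.

Lemma sqr_gt0 (d : R) : d != 0 -> 0 < d * d.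
Proof. by move=> d0; rewrite -expr2 exprn_even_gt0. Qed.

Lemma smooth_at_norm_powR (p : R) f x : f x != 0 ->
  smooth_at f x -> smooth_at (fun y => `|f y| `^ p) x.
Proof.
move=> f0 sf; apply: (@smooth_at_near _ _ _ (fun y => (f y * f y) `^ (p / 2))).
  by apply: nearW => y; rewrite norm_powR_sqr.
by apply: smooth_at_powR; [exact: sqr_gt0|exact: smooth_at_mul].
Qed.

Lemma smooth_at_inv f x : f x != 0 -> smooth_at f x -> smooth_at (fun y => (f y)^-1) x.
Proof.
(* Writing 1/f as f times a power of the positive function f^2 covers negative values. *)
move=> f0 sf; apply: (@smooth_at_near _ _ _ (fun y => f y * (f y * f y) `^ (-1))).
  apply: nearW => y; rewrite powR_inv1; last by rewrite -expr2 sqr_ge0.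
  have [->|y0] := eqVneq (f y) 0; first by rewrite mul0r invr0.
  by rewrite invfM mulrA divff // mul1r.
apply: smooth_at_mul => //.
by apply: smooth_at_powR; [exact: sqr_gt0|exact: smooth_at_mul].
Qed.

Lemma smooth_at_jac i j a b x : cdom i x -> cdom j x ->
  smooth_at (fun y => jac i j y a b) x.
Proof.
move=> ix jx; apply: (@smooth_at_near _ _ _ (pd i a (fun y => cto j y 0 b))).
  by apply: nearW => y; rewrite mxE.
by apply: smooth_at_pd => //; exact: smooth_at_coord.
Qed.

Lemma smooth_at_det (A : M -> 'M[R]_n.+1) x :
  (forall a b, smooth_at (fun y => A y a b) x) -> smooth_at (fun y => \det (A y)) x.
Proof.
move=> sA; apply: smooth_at_sum => s; apply: smooth_at_mul; first exact: smooth_at_cst.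
by apply: smooth_at_prod => a; exact: sA.
Qed.

Lemma smooth_at_det_jac (p : R) i j x : cdom i x -> cdom j x ->
  smooth_at (fun y => `|\det (jac i j y)| `^ p) x.
Proof.
move=> ix jx; apply: smooth_at_norm_powR; first exact: det_jac_neq0.
by apply: smooth_at_det => a b; exact: smooth_at_jac.
Qed.

Lemma vf_in_at X x : vf_in (chart_at x) X x = X x.
Proof. by rewrite /vf_in jac_id ?mulmx1 //; exact: (chart_atP x). Qed.

Lemma dens_in_at p s x : dens_in p (chart_at x) s x = s x.
Proof.
rewrite /dens_in jac_id ?det1 ?normr1 ?powR1 ?mulr1 //; exact: (chart_atP x).
Qed.

Lemma vf_in_change i j X x : cdom i x -> cdom j x ->
  vf_in j X x = vf_in i X x *m jac i j x.
Proof.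
by move=> ix jx; rewrite /vf_in -mulmxA -jac_cocycle //; exact: (chart_atP x).
Qed.

Lemma form_in_change i j U x : cdom i x -> cdom j x ->
  form_in j U x = jac j i x *m form_in i U x.
Proof.
by move=> ix jx; rewrite /form_in mulmxA -jac_cocycle //; exact: (chart_atP x).
Qed.

Lemma dens_in_change p i j s x : cdom i x -> cdom j x ->
  dens_in p j s x = `|\det (jac j i x)| `^ p * dens_in p i s x.
Proof.
move=> ix jx; rewrite /dens_in (@jac_cocycle _ _ _ j i) //; last exact: (chart_atP x).
by rewrite det_mulmx normrM powRM // mulrCA.
Qed.

Lemma vf_in_frame i j k x : cdom i x -> cdom j x ->
  vf_in j (frame i k) x = row k (jac i j x).
Proof.
by move=> ix jx; rewrite /vf_in /frame -row_mul -jac_cocycle //; exact: (chart_atP x).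
Qed.

Lemma frame_at k x : frame (chart_at x) k x = row k 1%:M.
Proof. by rewrite /frame jac_id //; exact: (chart_atP x). Qed.

(** The chart is that of [x], kept fixed while the point [y] moves; this makes smoothness
    insensitive to the jumps of [chart_at]. The next two definitions do the same. *)
Definition vsmooth X x := forall k, smooth_at (fun y => vf_in (chart_at x) X y 0 k) x.
Definition fsmooth U x := forall k, smooth_at (fun y => form_in (chart_at x) U y k 0) x.
Definition dsmooth p s x := smooth_at (dens_in p (chart_at x) s) x.

Lemma smooth_vf_change i j X x : cdom i x -> cdom j x ->
  (forall k, smooth_at (fun y => vf_in i X y 0 k) x) ->
  forall k, smooth_at (fun y => vf_in j X y 0 k) x.
Proof.
move=> ix jx sX k; apply: (@smooth_at_near _ _ _
  (fun y => \sum_a vf_in i X y 0 a * jac i j y a k)).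
  apply: filterS2 (near_cdom ix) (near_cdom jx) => y iy jy.
  by rewrite (@vf_in_change i j) // mxE.
by apply: smooth_at_sum => a; apply: smooth_at_mul => //; exact: smooth_at_jac.
Qed.

Lemma smooth_form_change i j U x : cdom i x -> cdom j x ->
  (forall k, smooth_at (fun y => form_in i U y k 0) x) ->
  forall k, smooth_at (fun y => form_in j U y k 0) x.
Proof.
move=> ix jx sX k; apply: (@smooth_at_near _ _ _
  (fun y => \sum_a jac j i y k a * form_in i U y a 0)).
  apply: filterS2 (near_cdom ix) (near_cdom jx) => y iy jy.
  by rewrite (@form_in_change i j) // mxE.
by apply: smooth_at_sum => a; apply: smooth_at_mul => //; exact: smooth_at_jac.
Qed.

Lemma smooth_dens_change p i j s x : cdom i x -> cdom j x ->
  smooth_at (dens_in p i s) x -> smooth_at (dens_in p j s) x.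
Proof.
move=> ix jx sX; apply: (@smooth_at_near _ _ _
  (fun y => `|\det (jac j i y)| `^ p * dens_in p i s y)).
  apply: filterS2 (near_cdom ix) (near_cdom jx) => y iy jy.
  by rewrite (@dens_in_change p i j).
by apply: smooth_at_mul => //; exact: smooth_at_det_jac.
Qed.

Lemma vsmooth_in i X x : cdom i x ->
  vsmooth X x <-> forall k, smooth_at (fun y => vf_in i X y 0 k) x.
Proof.
by move=> ix; split; apply: smooth_vf_change => //; exact: (chart_atP x).
Qed.

Lemma fsmooth_in i U x : cdom i x ->
  fsmooth U x <-> forall k, smooth_at (fun y => form_in i U y k 0) x.
Proof.
by move=> ix; split; apply: smooth_form_change => //; exact: (chart_atP x).
Qed.

Lemma dsmooth_in p i s x : cdom i x ->
  dsmooth p s x <-> smooth_at (dens_in p i s) x.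
Proof.
by move=> ix; split; apply: smooth_dens_change => //; exact: (chart_atP x).
Qed.

Lemma open_cdomI V i : open V -> open (V `&` cdom i).
Proof. by move=> oV; apply: openI => //; exact: cdom_open. Qed.

Lemma smooth_vfP V X : open V -> smooth_vf V X <-> forall x, V x -> vsmooth X x.
Proof.
move=> oV; split => [sX x Vx k|sX i k].
  have cx := chart_atP x.
  by have /smooth_fun_at := sX (chart_at x) k; apply => //; exact: open_cdomI.
apply/smooth_fun_at; first exact: open_cdomI.
by move=> x [Vx ix]; apply: (vsmooth_in _ ix).1; exact: sX.
Qed.

Lemma smooth_formP V U : open V -> smooth_form V U <-> forall x, V x -> fsmooth U x.
Proof.
move=> oV; split => [sX x Vx k|sX i k].
  have cx := chart_atP x.
  by have /smooth_fun_at := sX (chart_at x) k; apply => //; exact: open_cdomI.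
apply/smooth_fun_at; first exact: open_cdomI.
by move=> x [Vx ix]; apply: (fsmooth_in _ ix).1; exact: sX.
Qed.

Lemma smooth_densP p V s : open V ->
  smooth_dens p V s <-> forall x, V x -> dsmooth p s x.
Proof.
move=> oV; split => [sX x Vx|sX i].
  have cx := chart_atP x.
  by have /smooth_fun_at := sX (chart_at x); apply => //; exact: open_cdomI.
apply/smooth_fun_at; first exact: open_cdomI.
by move=> x [Vx ix]; apply: (dsmooth_in _ _ ix).1; exact: sX.
Qed.

Lemma vsmooth_frame i k x : cdom i x -> vsmooth (frame i k) x.
Proof.
move=> ix b; apply: (@smooth_at_near _ _ _ (fun y => jac i (chart_at x) y k b)).
  apply: filterS2 (near_cdom ix) (near_cdom (chart_atP x)) => y iy cy.
  by rewrite vf_in_frame // [RHS]mxE.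
by apply: smooth_at_jac => //; exact: (chart_atP x).
Qed.

Lemma vsmooth_near X Y x : (\near x, X x = Y x) -> vsmooth X x -> vsmooth Y x.
Proof.
move=> XY sX k; apply: smooth_at_near (sX k).
by apply: filterS XY => y; rewrite /vf_in => ->.
Qed.

Lemma vsmooth_add X Y x : vsmooth X x -> vsmooth Y x ->
  vsmooth (fun y => X y + Y y) x.
Proof.
move=> sX sY k; apply: smooth_at_near (smooth_at_add (sX k) (sY k)).
by apply: nearW => y; rewrite /vf_in mulmxDl [in RHS]mxE.
Qed.

Lemma vsmooth_scale f X x : smooth_at f x -> vsmooth X x ->
  vsmooth (fun y => f y *: X y) x.
Proof.
move=> sf sX k; apply: smooth_at_near (smooth_at_mul sf (sX k)).
by apply: nearW => y; rewrite /vf_in -scalemxAl [in RHS]mxE.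
Qed.

Lemma vf_app_chart i X f x : cdom i x -> smooth_at f x ->
  vf_app X f x = \sum_k vf_in i X x 0 k * pd i k f x.
Proof.
move=> ix sf; have cx := chart_atP x.
rewrite /vf_app (eq_bigr (fun k => \sum_a X x 0 k * jac (chart_at x) i x k a * pd i a f x)).
  rewrite exchange_big /=; apply: eq_bigr => a _.
  by rewrite -big_distrl /= /vf_in [in RHS]mxE.
move=> k _; rewrite (@pd_chain _ _ _ (chart_at x) i) // big_distrr /=.
by apply: eq_bigr => a _; rewrite mulrA.
Qed.

Lemma smooth_at_vf_app X f x : vsmooth X x -> smooth_at f x ->
  smooth_at (vf_app X f) x.
Proof.
move=> sX sf; have cx := chart_atP x.
apply: (@smooth_at_near _ _ _
  (fun y => \sum_k vf_in (chart_at x) X y 0 k * pd (chart_at x) k f y)).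
  apply: filterS2 (near_cdom cx) (smooth_at_nbhs sf) => y cy fy.
  by rewrite (@vf_app_chart (chart_at x)).
by apply: smooth_at_sum => k; apply: smooth_at_mul; [exact: sX|exact: smooth_at_pd].
Qed.

Lemma vf_app_near X f g x : smooth_at f x -> (\near x, f x = g x) ->
  vf_app X f x = vf_app X g x.
Proof.
move=> sf fg; apply: eq_bigr => k _; congr (_ * _).
by apply: pd_near => //; exact: (chart_atP x).
Qed.

Lemma vf_app_cst X (c : R) x : vf_app X (fun=> c) x = 0.
Proof.
by rewrite /vf_app big1 // => k _; rewrite pd_cst ?mulr0 //; exact: (chart_atP x).
Qed.

Lemma vf_app_add X f g x : smooth_at f x -> smooth_at g x ->
  vf_app X (fun y => f y + g y) x = vf_app X f x + vf_app X g x.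
Proof.
move=> sf sg; rewrite /vf_app -big_split /=; apply: eq_bigr => k _.
by rewrite pd_add ?mulrDr //; exact: (chart_atP x).
Qed.

Lemma vf_app_mul X f g x : smooth_at f x -> smooth_at g x ->
  vf_app X (fun y => f y * g y) x = f x * vf_app X g x + g x * vf_app X f x.
Proof.
move=> sf sg; rewrite /vf_app !big_distrr -big_split /=; apply: eq_bigr => k _.
rewrite pd_mul //; last exact: (chart_atP x).
by rewrite mulrDr; congr (_ + _); rewrite mulrCA.
Qed.

Lemma vf_app_powR X (p : R) f x : 0 < f x -> smooth_at f x ->
  vf_app X (fun y => f y `^ p) x = p * f x `^ (p - 1) * vf_app X f x.
Proof.
move=> f0 sf; rewrite /vf_app big_distrr /=; apply: eq_bigr => k _.
by rewrite pd_powR //; [rewrite mulrCA|exact: (chart_atP x)].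
Qed.

Lemma vf_app_norm_powR X (p : R) f x : f x != 0 -> smooth_at f x ->
  vf_app X (fun y => `|f y| `^ p) x = p * `|f x| `^ p * (f x)^-1 * vf_app X f x.
Proof.
move=> f0 sf; have -> : (fun y => `|f y| `^ p) = (fun y => (f y * f y) `^ (p / 2)).
  by apply/funext => y; exact: norm_powR_sqr.
rewrite vf_app_powR; [|exact: sqr_gt0|exact: smooth_at_mul].
rewrite vf_app_mul // norm_powR_sqr powRB; last first.
  by rewrite mulf_neq0 // implybT.
rewrite powRr1; last by rewrite ltW // sqr_gt0.
by field.
Qed.

Lemma vf_app_sum X (I : Type) (r : seq I) (F : I -> M -> R) x :
  (forall a, smooth_at (F a) x) ->
  vf_app X (fun y => \sum_(a <- r) F a y) x = \sum_(a <- r) vf_app X (F a) x.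
Proof.
move=> sF; elim: r => [|a r IH].
  rewrite big_nil -[RHS](vf_app_cst X 0 x); congr vf_app.
  by apply/funext => y; rewrite big_nil.
rewrite big_cons -IH -vf_app_add //; last exact: smooth_at_sum.
by congr vf_app; apply/funext => y; rewrite big_cons.
Qed.

(** The omitted factor is recognised by its index, hence the distinct indices. *)
Lemma vf_app_prod X (I : eqType) (r : seq I) (F : I -> M -> R) x : uniq r ->
  (forall a, smooth_at (F a) x) ->
  vf_app X (fun y => \prod_(a <- r) F a y) x =
  \sum_(a <- r) vf_app X (F a) x * \prod_(b <- r | a != b) F b x.
Proof.
move=> + sF; elim: r => [|a r IH] /= => [_|/andP[ar ur]].
  rewrite big_nil -[RHS](vf_app_cst X 1 x); congr vf_app.
  by apply/funext => y; rewrite big_nil.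
rewrite big_cons (_ : (fun y => _) = (fun y => F a y * \prod_(b <- r) F b y)).
  2: by apply/funext => y; rewrite big_cons.
rewrite vf_app_mul //; last exact: smooth_at_prod.
rewrite addrC IH //; congr (_ + _).
  rewrite mulrC big_cons eqxx /=; congr (_ * _).
  rewrite big_seq [RHS]big_seq_cond; apply: eq_bigl => b.
  by case: (boolP (b \in r)) => //= br; apply/esym/eqP => ab; rewrite ab br in ar.
rewrite big_distrr big_seq [RHS]big_seq; apply: eq_bigr => c cr.
rewrite big_cons ifT; last by apply/eqP => ca; rewrite -ca cr in ar.
by rewrite mulrCA.
Qed.

(** Differentiate the expansion over permutations one row at a time, then group the permutations by
    the image of the differentiated row: each group is a cofactor. *)
Lemma vf_app_det X (A : M -> 'M[R]_n.+1) x :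
  (forall a b, smooth_at (fun y => A y a b) x) ->
  vf_app X (fun y => \det (A y)) x =
  \sum_a \sum_b vf_app X (fun y => A y a b) x * cofactor (A x) a b.
Proof.
move=> sA; rewrite vf_app_sum; last first.
  move=> s; apply: smooth_at_mul; first exact: smooth_at_cst.
  by apply: smooth_at_prod => a; exact: sA.
rewrite (eq_bigr (fun s : 'S_n.+1 => \sum_a (-1) ^+ s *
  (vf_app X (fun y => A y a (s a)) x * \prod_(b | a != b) A x b (s b)))); last first.
  move=> s _; rewrite vf_app_mul; [|exact: smooth_at_cst|exact: smooth_at_prod].
  by rewrite vf_app_cst mulr0 addr0 vf_app_prod ?index_enum_uniq // big_distrr.
rewrite exchange_big /=; apply: eq_bigr => a _.
rewrite (partition_big (fun s : 'S_n.+1 => s a) xpredT) //=; apply: eq_bigr => b _.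
rewrite expand_cofactor big_distrr /=; apply: eq_bigr => s /eqP <-.
by rewrite mulrCA.
Qed.

(* Jacobi's formula for the Jacobian determinant of a change of charts. *)
Lemma vf_app_det_jac X (p : R) i j x : cdom i x -> cdom j x ->
  vf_app X (fun y => `|\det (jac j i y)| `^ p) x =
  p * `|\det (jac j i x)| `^ p *
    \sum_a \sum_b vf_app X (fun y => jac j i y a b) x * jac i j x b a.
Proof.
move=> ix jx; have d0 := det_jac_neq0 jx ix.
have sJ a b : smooth_at (fun y => jac j i y a b) x by exact: smooth_at_jac.
rewrite vf_app_norm_powR //; last exact: smooth_at_det.
rewrite vf_app_det // -mulrA; congr (_ * _).
rewrite big_distrr /=; apply: eq_bigr => a _.
rewrite big_distrr /=; apply: eq_bigr => b _.
rewrite mulrCA; congr (_ * _).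
have /matrixP/(_ b a) : \adj (jac j i x) = \det (jac j i x) *: jac i j x.
  rewrite -[LHS]mulmx1 -(jacK jx ix) mulmxA mul_adj_mx.
  by rewrite mul_scalar_mx.
by rewrite !mxE => ->; rewrite mulKf.
Qed.

End Tensors.

(** * Affine connections *)

Section Connections.
Context {R : realType} {n : nat} {M : bmanifold R n}.
Notation E := 'rV[R]_n.+1.
Notation e_ := (@ebase R n).
Implicit Types (i j : bm_index M) (k : 'I_n.+1) (x y : M) (f g : M -> R)
  (X Y Z : vfield M) (U : Defs.form M) (s : density M) (p : R) (V W : set M)
  (D : vfield M -> vfield M -> vfield M).

Lemma near_open_sub W x (P : M -> Prop) : open W -> W x -> (\near x, P x) ->
  exists V, [/\ open V, V `<=` W, V x & forall y, V y -> P y].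
Proof.
move=> oW Wx /near_openP[V [oV Vx VP]]; exists (V `&` W).
split; [exact: openI|by move=> y []|by split|by move=> y [Vy _]; exact: VP].
Qed.

Lemma vsmooth_nbhs X x : vsmooth X x -> \forall y \near x, vsmooth X y.
Proof.
move=> sX; have cx := chart_atP x.
have := @filter_forall M 'I_n.+1
  (fun k y => smooth_at (fun z => vf_in (chart_at x) X z 0 k) y)
  (nbhs x) (nbhs_filter x) (fun k => smooth_at_nbhs (sX k)).
by apply: filterS2 (near_cdom cx) => y cy H; apply/(vsmooth_in _ cy).
Qed.

Lemma dsmooth_nbhs p s x : dsmooth p s x -> \forall y \near x, dsmooth p s y.
Proof.
move=> ss; have cx := chart_atP x.
by apply: filterS2 (near_cdom cx) (smooth_at_nbhs ss) => y cy H; apply/(dsmooth_in _ _ cy).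
Qed.

Lemma vsmooth_cst0 x : vsmooth (fun=> 0) x.
Proof.
move=> k; apply: smooth_at_near (smooth_at_cst 0 x).
by apply: nearW => y; rewrite /vf_in mul0mx mxE.
Qed.

(** * Connection axioms at a point, traces and derivatives of densities *)

Section AffineConnection.
Variables (W : set M) (D : vfield M -> vfield M -> vfield M).
Hypotheses (oW : open W) (hD : affine_connection W D).

(** The axioms speak of fields smooth on an open subset of [W]. Smoothness at [x] spreads to a
    neighbourhood, which serves as that subset; the other pointwise axioms are obtained likewise. *)
Lemma connl_smooth X Y x : W x -> vsmooth X x -> vsmooth Y x -> vsmooth (D X Y) x.
Proof.
move=> Wx /vsmooth_nbhs sX /vsmooth_nbhs sY.
have [V [oV VW Vx VP]] := near_open_sub oW Wx (filterI sX sY).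
have := conn_smooth hD (X := X) (Y := Y) oV VW.
rewrite !smooth_vfP //; apply => // y /VP[] //.
Qed.

Lemma connl_local X X' Y Y' x : W x -> vsmooth X x -> vsmooth Y x ->
  (\near x, X x = X' x) -> (\near x, Y x = Y' x) -> D X Y x = D X' Y' x.
Proof.
move=> Wx sX sY XX' YY'.
have /vsmooth_nbhs sX' := vsmooth_near XX' sX.
have /vsmooth_nbhs sY' := vsmooth_near YY' sY.
have [V [oV VW Vx VP]] := near_open_sub oW Wx (filterI (filterI (vsmooth_nbhs sX)
  (vsmooth_nbhs sY)) (filterI (filterI sX' sY') (filterI XX' YY'))).
have H := conn_local hD (X := X) (X' := X') (Y := Y) (Y' := Y') oV VW.
rewrite !smooth_vfP // in H.
by apply: H => // y /VP[[? ?] [[? ?] [? ?]]].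
Qed.

Lemma connl_addl X X' Y x : W x -> vsmooth X x -> vsmooth X' x -> vsmooth Y x ->
  D (fun y => X y + X' y) Y x = D X Y x + D X' Y x.
Proof.
move=> Wx /vsmooth_nbhs sX /vsmooth_nbhs sX' /vsmooth_nbhs sY.
have [V [oV VW Vx VP]] := near_open_sub oW Wx (filterI (filterI sX sX') sY).
have H := conn_addl hD (X := X) (X' := X') (Y := Y) oV VW.
by rewrite !smooth_vfP // in H; apply: H => // y /VP[[? ?] ?].
Qed.

Lemma connl_addr X Y Y' x : W x -> vsmooth X x -> vsmooth Y x -> vsmooth Y' x ->
  D X (fun y => Y y + Y' y) x = D X Y x + D X Y' x.
Proof.
move=> Wx /vsmooth_nbhs sX /vsmooth_nbhs sX' /vsmooth_nbhs sY.
have [V [oV VW Vx VP]] := near_open_sub oW Wx (filterI (filterI sX sX') sY).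
have H := conn_addr hD (X := X) (Y := Y) (Y' := Y') oV VW.
by rewrite !smooth_vfP // in H; apply: H => // y /VP[[? ?] ?].
Qed.

Lemma connl_scalel f X Y x : W x -> smooth_at f x -> vsmooth X x -> vsmooth Y x ->
  D (fun y => f y *: X y) Y x = f x *: D X Y x.
Proof.
move=> Wx /smooth_at_nbhs sX /vsmooth_nbhs sX' /vsmooth_nbhs sY.
have [V [oV VW Vx VP]] := near_open_sub oW Wx (filterI (filterI sX sX') sY).
have H := conn_scalel hD (f := f) (X := X) (Y := Y) oV VW.
by rewrite !smooth_vfP // smooth_fun_at // in H; apply: H => // y /VP[[? ?] ?].
Qed.

Lemma connl_leibniz f X Y x : W x -> smooth_at f x -> vsmooth X x -> vsmooth Y x ->
  D X (fun y => f y *: Y y) x = vf_app X f x *: Y x + f x *: D X Y x.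
Proof.
move=> Wx /smooth_at_nbhs sX /vsmooth_nbhs sX' /vsmooth_nbhs sY.
have [V [oV VW Vx VP]] := near_open_sub oW Wx (filterI (filterI sX sX') sY).
have H := conn_leibniz hD (f := f) (X := X) (Y := Y) oV VW.
by rewrite !smooth_vfP // smooth_fun_at // in H; apply: H => // y /VP[[? ?] ?].
Qed.

Lemma vsmooth_sum (r : seq 'I_n.+1) (F : 'I_n.+1 -> vfield M) x :
  (forall k, vsmooth (F k) x) -> vsmooth (fun y => \sum_(k <- r) F k y) x.
Proof.
move=> sF; elim: r => [|k r IH].
  by apply: vsmooth_near (vsmooth_cst0 x); apply: nearW => y; rewrite big_nil.
apply: vsmooth_near (vsmooth_add (sF k) IH).
by apply: nearW => y; rewrite big_cons.
Qed.

Lemma connl_suml (r : seq 'I_n.+1) (c : 'I_n.+1 -> M -> R) (F : 'I_n.+1 -> vfield M) Y x :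
  W x -> (forall k, smooth_at (c k) x) -> (forall k, vsmooth (F k) x) -> vsmooth Y x ->
  D (fun y => \sum_(k <- r) c k y *: F k y) Y x = \sum_(k <- r) c k x *: D (F k) Y x.
Proof.
move=> Wx sc sF sY; elim: r => [|k r IH].
  rewrite big_nil -[RHS](scale0r (D Y Y x)).
  rewrite -(connl_scalel Wx (smooth_at_cst 0 x) sY sY).
  have s0 := vsmooth_scale (smooth_at_cst 0 x) sY.
  apply/esym/connl_local => //; apply: nearW => y //.
  by rewrite big_nil scale0r.
have s1 := vsmooth_scale (sc k) (sF k).
have s2 := vsmooth_sum r (fun k => vsmooth_scale (sc k) (sF k)).
rewrite big_cons -IH -connl_scalel // -connl_addl //.
apply/esym/connl_local => //; first exact: vsmooth_add.
  by apply: nearW => y; rewrite big_cons.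
exact: nearW.
Qed.

Lemma connl_sumr (r : seq 'I_n.+1) X (c : 'I_n.+1 -> M -> R) (F : 'I_n.+1 -> vfield M) x :
  W x -> vsmooth X x -> (forall k, smooth_at (c k) x) -> (forall k, vsmooth (F k) x) ->
  D X (fun y => \sum_(k <- r) c k y *: F k y) x =
  \sum_(k <- r) (vf_app X (c k) x *: F k x + c k x *: D X (F k) x).
Proof.
move=> Wx sX sc sF; elim: r => [|k r IH].
  rewrite big_nil; transitivity (D X (fun y => 0 *: X y) x).
    apply/esym/connl_local => //; first exact: vsmooth_scale (smooth_at_cst 0 x) sX.
      exact: nearW.
    by apply: nearW => y; rewrite big_nil scale0r.
  by rewrite (connl_leibniz Wx (smooth_at_cst 0 x)) // vf_app_cst !scale0r addr0.
have s1 := vsmooth_scale (sc k) (sF k).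
have s2 := vsmooth_sum r (fun k => vsmooth_scale (sc k) (sF k)).
rewrite big_cons -IH -connl_leibniz // -connl_addr //.
apply/esym/connl_local => //; first exact: vsmooth_add.
  exact: nearW.
by apply: nearW => y; rewrite big_cons.
Qed.

Lemma vf_frame_sum i X y : cdom i y ->
  X y = \sum_k vf_in i X y 0 k *: frame i k y.
Proof.
move=> iy; have cy := chart_atP y.
by rewrite -{1}(vf_in_at X) (@vf_in_change _ _ _ i) // mulmx_sum_row.
Qed.

(** Linearity over functions in the first slot makes the derivative depend on [X] only through its
    value at [x]. *)
Lemma connl_tensorial i X Y x : W x -> cdom i x -> vsmooth X x -> vsmooth Y x ->
  D X Y x = \sum_k vf_in i X x 0 k *: D (frame i k) Y x.
Proof.
move=> Wx ix sX sY.
rewrite -(connl_suml _ (c := fun k y => vf_in i X y 0 k) (F := frame i)) //;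
  first last.
- by move=> k; exact: vsmooth_frame.
- exact: (vsmooth_in _ ix).1 sX.
apply: connl_local => //; last exact: nearW.
by apply: filterS (near_cdom ix) => y iy; exact: vf_frame_sum.
Qed.

(** Minus the connection form of vol in the trivialisation by the coordinate density of chart [i],
    evaluated on [X]. *)
Definition ctrace i X x : R := \sum_k vf_in i (D X (frame i k)) x 0 k.

Lemma smooth_at_ctrace i X x : W x -> cdom i x -> vsmooth X x ->
  smooth_at (ctrace i X) x.
Proof.
move=> Wx ix sX; apply: smooth_at_sum => k; apply: (vsmooth_in _ ix).1.
by apply: connl_smooth => //; exact: vsmooth_frame.
Qed.

(** Expand the frame of [j] in that of [i] and apply the Leibniz rule. The terms differentiating the
    Jacobian J form tr(X(J) J^(-1)); the others are a conjugated trace. *)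
Lemma ctrace_change i j X x : W x -> cdom i x -> cdom j x -> vsmooth X x ->
  ctrace j X x = ctrace i X x +
    \sum_a \sum_b vf_app X (fun y => jac j i y a b) x * jac i j x b a.
Proof.
move=> Wx ix jx sX; have cx := chart_atP x.
have fE k y : cdom i y -> cdom j y ->
    frame j k y = \sum_a jac j i y k a *: frame i a y.
  move=> iy jy; rewrite (@vf_frame_sum i) //; apply: eq_bigr => a _.
  by rewrite vf_in_frame // mxE.
have DE k : D X (frame j k) x = \sum_a (vf_app X (fun y => jac j i y k a) x *: frame i a x
    + jac j i x k a *: D X (frame i a) x).
  rewrite -connl_sumr //; first last.
  - by move=> a; exact: vsmooth_frame.
  - by move=> a; exact: smooth_at_jac.
  apply: connl_local => //; [exact: vsmooth_frame|exact: nearW|].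
  by apply: filterS2 (near_cdom ix) (near_cdom jx) => y iy jy; exact: fE.
have E k : vf_in j (D X (frame j k)) x 0 k =
    \sum_a vf_app X (fun y => jac j i y k a) x * jac i j x a k +
    \sum_a \sum_b jac j i x k a * (vf_in i (D X (frame i a)) x 0 b * jac i j x b k).
  rewrite /vf_in DE mulmx_suml summxE -big_split /=; apply: eq_bigr => a _.
  rewrite mulmxDl -!scalemxAl mxE [X in X + _]mxE [X in _ + X]mxE.
  rewrite -[X in _ * X + _]/(vf_in j (frame i a) x 0 k) vf_in_frame // [row _ _ _ _]mxE.
  rewrite -[X in _ + _ * X]/(vf_in j (D X (frame i a)) x 0 k) (@vf_in_change _ _ _ i j) //.
  by rewrite [X in _ + _ * X]mxE big_distrr.
rewrite /ctrace (eq_bigr _ (fun k _ => E k)) big_split /= addrC; congr (_ + _).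
rewrite exchange_big /=; apply: eq_bigr => a _.
(* Summing over [k] first produces entries of a product of inverse Jacobians, so only the diagonal
   term b = a survives. *)
rewrite exchange_big /= (bigD1 a) //= [X in _ + X]big1 ?addr0 => [|b ba].
  rewrite (eq_bigr (fun k => vf_in i (D X (frame i a)) x 0 a * (jac i j x a k * jac j i x k a))).
    rewrite -big_distrr /=; have /matrixP/(_ a a) := jacK ix jx.
    by rewrite !mxE eqxx => ->; rewrite mulr1.
  by move=> k _; ring.
rewrite (eq_bigr (fun k => vf_in i (D X (frame i a)) x 0 b * (jac i j x b k * jac j i x k a))).
  rewrite -big_distrr /=; have /matrixP/(_ b a) := jacK ix jx.
  by rewrite !mxE (negPf ba) => ->; rewrite mulr0.
by move=> k _; ring.
Qed.

(* The coefficient in chart [i] of the covariant derivative of a section of vol^p. *)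
Definition dens_deriv_in p i X s x : R :=
  vf_app X (dens_in p i s) x - p * ctrace i X x * dens_in p i s x.

(** The derivative of the transition factor, given by [vf_app_det_jac], is exactly [p] times the
    inhomogeneous term of [ctrace_change]; the two cancel, so the covariant derivative transforms
    like a section of vol^p. *)
Lemma dens_deriv_in_change p i j X s x : W x -> cdom i x -> cdom j x ->
  vsmooth X x -> dsmooth p s x ->
  dens_deriv_in p j X s x = `|\det (jac j i x)| `^ p * dens_deriv_in p i X s x.
Proof.
move=> Wx ix jx sX ss.
have ssi := (dsmooth_in p s ix).1 ss; have ssj := (dsmooth_in p s jx).1 ss.
have dE : \forall y \near x, dens_in p j s y = `|\det (jac j i y)| `^ p * dens_in p i s y.
  by apply: filterS2 (near_cdom ix) (near_cdom jx) => y iy jy; exact: dens_in_change.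
have E1 : vf_app X (dens_in p j s) x = _ := vf_app_near X ssj dE.
have E2 : dens_in p j s x = _ := dens_in_change p s ix jx.
have E3 : ctrace j X x = _ := ctrace_change Wx ix jx sX.
have E4 := vf_app_mul X (smooth_at_det_jac p jx ix) ssi.
have E5 := vf_app_det_jac X p ix jx.
have alg (N v d t S : R) :
    N * v + d * (p * N * S) - p * (t + S) * (N * d) = N * (v - p * t * d) by ring.
by rewrite /dens_deriv_in [X in X - _ = _]E1 E2 E3 E4 E5; exact: alg.
Qed.

Lemma dens_deriv_at p X s x : dens_deriv p D X s x = dens_deriv_in p (chart_at x) X s x.
Proof.
rewrite /dens_deriv /dens_deriv_in dens_in_at; congr (_ - _ * _ * _).
by apply: eq_bigr => k _; rewrite vf_in_at.
Qed.

Lemma dens_deriv_chart p i X s x : W x -> cdom i x -> vsmooth X x -> dsmooth p s x ->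
  dens_deriv p D X s x = `|\det (jac (chart_at x) i x)| `^ p * dens_deriv_in p i X s x.
Proof.
move=> Wx ix sX ss; rewrite dens_deriv_at; apply: dens_deriv_in_change => //.
exact: (chart_atP x).
Qed.

Lemma vf_app_frame i k f x : cdom i x -> smooth_at f x -> vf_app (frame i k) f x = pd i k f x.
Proof.
move=> ix sf; rewrite (vf_app_chart _ ix sf) (bigD1 k) //= big1 ?addr0 => [|b bk].
  by rewrite vf_in_frame // jac_id // !mxE eqxx mul1r.
by rewrite vf_in_frame // jac_id // !mxE eq_sym (negPf bk) mul0r.
Qed.

Lemma dens_deriv_tensorial p i X s x : W x -> cdom i x -> vsmooth X x -> dsmooth p s x ->
  dens_deriv p D X s x = \sum_k vf_in i X x 0 k * dens_deriv p D (frame i k) s x.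
Proof.
move=> Wx ix sX ss; have cx := chart_atP x.
rewrite /dens_deriv (vf_app_chart _ ix ss).
rewrite [RHS](eq_bigr (fun k => vf_in i X x 0 k * pd i k (dens_in p (chart_at x) s) x -
  vf_in i X x 0 k * (p * (\sum_b D (frame i k) (frame (chart_at x) b) x 0 b) * s x))).
  rewrite sumrB; congr (_ - _).
  rewrite (eq_bigr (fun b => \sum_k vf_in i X x 0 k * D (frame i k) (frame (chart_at x) b) x 0 b)).
    rewrite exchange_big /= mulrAC big_distrr /=; apply: eq_bigr => k _.
    by rewrite -big_distrr /=; ring.
  move=> b _; rewrite (connl_tensorial Wx ix sX (vsmooth_frame b cx)) summxE.
  by apply: eq_bigr => k _; rewrite mxE.
by move=> k _; rewrite -mulrBr vf_app_frame.
Qed.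

End AffineConnection.

(** Of the two correction terms, the first is scalar and contributes n+1 times U(X) to the trace;
    the second has rank at most one and contributes U(X) once more. *)
Lemma dens_deriv_conn_add p D U X s x :
  dens_deriv p (conn_add D U) X s x =
  dens_deriv p D X s x - p * n.+2%:R * form_app U X x * s x.
Proof.
have cx := chart_atP x; rewrite /dens_deriv.
have -> : \sum_k conn_add D U X (frame (chart_at x) k) x 0 k =
    \sum_k D X (frame (chart_at x) k) x 0 k + n.+2%:R * form_app U X x.
  rewrite (eq_bigr (fun k => D X (frame (chart_at x) k) x 0 k + form_app U X x
     + U x k 0 * X x 0 k)); last first.
    move=> k _.
    have EM (u v w : E) (a b : R) :
        (u + a *: v + b *: w) 0 k = u 0 k + a * v 0 k + b * w 0 k by rewrite !mxE.
    rewrite /conn_add EM frame_at [row _ _ _ _]mxE [1%:M _ _]mxE eqxx mulr1.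
    by congr (_ + _ * _); rewrite /form_app frame_at -row_mul mul1mx mxE.
  rewrite !big_split /= sumr_const card_ord -addrA; congr (_ + _).
  rewrite -[n.+2]addn1 natrD mulrDl mul1r mulr_natl; congr (_ + _).
  by rewrite [RHS]mxE; apply: eq_bigr => k _; rewrite mulrC.
ring.
Qed.

Lemma dens_deriv_conn_eq p W D D' X s x : open W -> conn_eq W D D' -> W x ->
  vsmooth X x -> dens_deriv p D X s x = dens_deriv p D' X s x.
Proof.
move=> oW DD' Wx sX; have cx := chart_atP x; rewrite /dens_deriv.
congr (_ - _ * _ * _); apply: eq_bigr => k _.
have [V [oV VW Vx VP]] := near_open_sub oW Wx
  (filterI (vsmooth_nbhs sX) (vsmooth_nbhs (vsmooth_frame k cx))).
rewrite (DD' V) // smooth_vfP // => y /VP[] //.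
Qed.

Lemma dens_in_mul p i f s x : dens_in p i (fun y => f y * s y) x = f x * dens_in p i s x.
Proof. by rewrite /dens_in mulrA. Qed.

Lemma dsmooth_mul p f s x : smooth_at f x -> dsmooth p s x ->
  dsmooth p (fun y => f y * s y) x.
Proof.
move=> sf ss; apply: smooth_at_near (smooth_at_mul sf ss).
by apply: nearW => y; rewrite dens_in_mul.
Qed.

Lemma dsmooth_near p s s' x : (\near x, s x = s' x) -> dsmooth p s x -> dsmooth p s' x.
Proof.
move=> ss'; apply: smooth_at_near; apply: filterS ss' => y.
by rewrite /dens_in => ->.
Qed.

Lemma dens_deriv_mul p D X f s x : smooth_at f x -> dsmooth p s x ->
  dens_deriv p D X (fun y => f y * s y) x =
  vf_app X f x * s x + f x * dens_deriv p D X s x.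
Proof.
move=> sf ss; rewrite /dens_deriv.
have -> : dens_in p (chart_at x) (fun y => f y * s y) =
    (fun y => f y * dens_in p (chart_at x) s y).
  by apply/funext => y; exact: dens_in_mul.
rewrite vf_app_mul // dens_in_at; ring.
Qed.

Lemma dens_deriv_near p D X s s' x : dsmooth p s x -> (\near x, s x = s' x) ->
  dens_deriv p D X s x = dens_deriv p D X s' x.
Proof.
move=> ss ss'; rewrite /dens_deriv (nbhs_singleton ss'); congr (_ - _).
by apply: vf_app_near => //; apply: filterS ss' => y; rewrite /dens_in => ->.
Qed.

Lemma smooth_at_form_app U X x : fsmooth U x -> vsmooth X x -> smooth_at (form_app U X) x.
Proof.
move=> sU sX; have cx := chart_atP x.
apply: (@smooth_at_near _ _ _ (fun y => \sum_k vf_in (chart_at x) X y 0 k *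
  form_in (chart_at x) U y k 0)).
  apply: filterS (near_cdom cx) => y cy.
  (* The two Jacobians are mutually inverse, so the pairing may be computed in the fixed chart. *)
  have -> : form_app U X y = (vf_in (chart_at x) X y *m form_in (chart_at x) U y) 0 0.
    have cy' := chart_atP y.
    by rewrite /vf_in /form_in mulmxA -[X y *m _ *m _]mulmxA jacK // mulmx1.
  by rewrite mxE.
by apply: smooth_at_sum => k; apply: smooth_at_mul.
Qed.

Lemma affine_connection_sub W W' D : W' `<=` W -> affine_connection W D ->
  affine_connection W' D.
Proof.
move=> WW' [h1 h2 h3 h4 h5 h6 h7].
have T V : V `<=` W' -> V `<=` W by move=> VW'; apply: subset_trans WW'.
split => V.
- by move=> X Y oV /T; exact: h1.
- by move=> X X' Y Y' oV /T; exact: h2.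
- by move=> X X' Y oV /T; exact: h3.
- by move=> f X Y oV /T; exact: h4.
- by move=> X Y Y' oV /T; exact: h5.
- by move=> f X Y oV /T; exact: h6.
- by move=> X Y oV /T; exact: h7.
Qed.

(** The added term is bilinear over functions, which preserves the Leibniz rule, and symmetric,
    which preserves the torsion. *)
Lemma conn_add_affine W D U : open W -> affine_connection W D -> smooth_form W U ->
  affine_connection W (conn_add D U).
Proof.
move=> oW hD; rewrite smooth_formP // => sU; split.
- move=> V X Y oV VW sX sY; rewrite smooth_vfP // => x Vx.
  have sXx := (smooth_vfP X oV).1 sX x Vx; have sYx := (smooth_vfP Y oV).1 sY x Vx.
  have sDx := (smooth_vfP _ oV).1 (conn_smooth hD oV VW sX sY) x Vx.
  have sUx := sU x (VW x Vx).
  by apply: vsmooth_add; [apply: vsmooth_add => //|];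
    apply: vsmooth_scale => //; exact: smooth_at_form_app.
- move=> V X X' Y Y' oV VW sX sX' sY sY' XX' YY' x Vx.
  by rewrite /conn_add /form_app (conn_local hD oV VW sX sX' sY sY' XX' YY' Vx) XX' ?YY'.
- move=> V X X' Y oV VW sX sX' sY x Vx.
  rewrite /conn_add /form_app (conn_addl hD oV VW sX sX' sY Vx) mulmxDl mxE.
  by rewrite scalerDl scalerDr [RHS]addrACA [X in _ = X + _]addrACA.
- move=> V f X Y oV VW sf sX sY x Vx.
  rewrite /conn_add /form_app (conn_scalel hD oV VW sf sX sY Vx) -scalemxAl mxE.
  by rewrite !scalerDr !scalerA [form_app U Y x * _]mulrC.
- move=> V X Y Y' oV VW sX sY sY' x Vx.
  rewrite /conn_add /form_app (conn_addr hD oV VW sX sY sY' Vx) mulmxDl [(Y x *m U x + _) 0 0]mxE.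
  by rewrite scalerDl scalerDr [RHS]addrACA [X in _ = X + _]addrACA.
- move=> V f X Y oV VW sf sX sY x Vx.
  rewrite /conn_add /form_app (conn_leibniz hD oV VW sf sX sY Vx) -scalemxAl.
  rewrite [(f x *: (Y x *m U x)) 0 0]mxE !scalerDr !scalerA !addrA.
  by rewrite [(X x *m U x) 0 0 * f x]mulrC.
- move=> V X Y oV VW sX sY x Vx.
  rewrite -(conn_torsion_free hD oV VW sX sY Vx) /conn_add.
  by apply/rowP => b; rewrite !mxE; ring.
Qed.

(* The logarithmic covariant derivative [nabla s / s]. *)
Definition logform p D s : Defs.form M := fun x =>
  \col_k ((s x)^-1 * dens_deriv p D (frame (chart_at x) k) s x).

Lemma form_app_logform p W D X s x : open W -> affine_connection W D -> W x ->
  vsmooth X x -> dsmooth p s x ->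
  form_app (logform p D s) X x = (s x)^-1 * dens_deriv p D X s x.
Proof.
move=> oW hD Wx sX ss; have cx := chart_atP x.
rewrite (dens_deriv_tensorial oW hD Wx cx sX ss) vf_in_at /form_app mxE big_distrr /=.
by apply: eq_bigr => k _; rewrite mxE mulrCA.
Qed.

(** In a fixed chart the transition factor of vol^p cancels between [s] and its derivative, leaving
    a quotient of smooth coefficients. *)
Lemma fsmooth_logform p W D s x : open W -> affine_connection W D -> W x ->
  dsmooth p s x -> s x != 0 -> fsmooth (logform p D s) x.
Proof.
move=> oW hD Wx ss s0 k; set i := chart_at x; have ix : cdom i x := chart_atP x.
apply: (@smooth_at_near _ _ _ (fun y => (dens_in p i s y)^-1 *
  (vf_app (frame i k) (dens_in p i s) y - p * ctrace D i (frame i k) y * dens_in p i s y))).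
  have nW : \near x, W x by exact: open_nbhs_nbhs.
  apply: filterS3 (near_cdom ix) nW (dsmooth_nbhs ss) => y iy Wy sy.
  have cy := chart_atP y.
  have -> : form_in i (logform p D s) y k 0 = (s y)^-1 * dens_deriv p D (frame i k) s y.
    rewrite (dens_deriv_tensorial oW hD Wy cy (vsmooth_frame k iy) sy).
    rewrite /form_in mxE big_distrr /=; apply: eq_bigr => a _.
    by rewrite vf_in_frame // [row _ _ _ _]mxE [X in _ * X]mxE mulrCA.
  rewrite (dens_deriv_chart oW hD Wy iy (vsmooth_frame k iy) sy).
  have sE : s y = `|\det (jac (chart_at y) i y)| `^ p * dens_in p i s y.
    by rewrite -(dens_in_change p s iy cy) dens_in_at.
  rewrite [X in _ = X^-1 * _]sE [X in _ = X * _]invfM [RHS]mulrACA mulVf ?mul1r //.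
  by rewrite gt_eqF // powR_gt0 // normr_gt0 det_jac_neq0.
have si : smooth_at (dens_in p i s) x := ss.
apply: smooth_at_mul.
  by apply: smooth_at_inv => //; rewrite /i dens_in_at.
apply: smooth_at_add.
  by apply: smooth_at_vf_app => //; exact: vsmooth_frame.
apply: smooth_at_opp; apply: smooth_at_mul => //; apply: smooth_at_mul.
  exact: smooth_at_cst.
by apply: (smooth_at_ctrace oW hD) => //; exact: vsmooth_frame.
Qed.

End Connections.

(** * Projective compactness *)

Section ProjectiveCompactness.
Context {R : realType} {n : nat} {M : bmanifold R n}.
Notation E := 'rV[R]_n.+1.
Notation e_ := (@ebase R n).
Implicit Types (i j : bm_index M) (k : 'I_n.+1) (x y : M) (f g rho : M -> R)
  (X Y Z : vfield M) (U : Defs.form M) (s tau : density M) (p alpha : R) (V W : set M)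
  (D : vfield M -> vfield M -> vfield M).

Lemma parallel_densP p W D s : open W ->
  parallel_dens p W D s <-> forall x X, W x -> vsmooth X x -> dens_deriv p D X s x = 0.
Proof.
move=> oW; split => [H x X Wx sX|H V X oV VW sX x Vx].
  have [V [oV VW Vx VP]] := near_open_sub oW Wx (vsmooth_nbhs sX).
  by apply: (H V) => //; rewrite smooth_vfP.
by apply: H; [exact: VW|exact: (smooth_vfP X oV).1].
Qed.

Lemma dens_in_neq0 p i s x : cdom i x -> s x != 0 -> dens_in p i s x != 0.
Proof.
move=> ix s0; rewrite mulf_neq0 // gt_eqF // powR_gt0 // normr_gt0 det_jac_neq0 //.
exact: (chart_atP x).
Qed.

(** Where the first coordinate is positive, a local extension coincides with [f \o cfrom i] on a
    full neighbourhood in [E], so the latter is smooth there in the ordinary sense. *)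
Lemma Cinf_on_local_rep i f (A : set E) :
  (forall z, A z -> [/\ 0 < z 0 ord0, cdom i (cfrom i z), cto i (cfrom i z) = z &
     smooth_at f (cfrom i z)]) ->
  Cinf_on A (f \o cfrom i) /\
  forall z k, A z -> 'D_(e_ k) (f \o cfrom i) z = pd i k f (cfrom i z).
Proof.
move=> HA.
have loc z : A z -> exists O (g : E -> R), [/\ open O, O z, Cinf_on O g,
    (forall y : E, O y -> g y = f (cfrom i y)) &
    forall k, 'D_(e_ k) g z = pd i k f (cfrom i z)].
  move=> /HA [z0 iz cz /(smooth_at_rep iz)[ O [g [oO Cg Oz fg]]]].
  have pos := near_gt0 (@coord_continuous R 1 n.+1 0 ord0 z) z0.
  have fgz := near_cfrom iz fg; rewrite cz in Oz fgz.
  have nO : \forall y \near z, O y by exact: open_nbhs_nbhs.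
  have [W [oW Wz HW]] := near_openP (filterI nO (filterI pos fgz)).
  exists W, g; split => //.
  - by move=> m; apply: Ck_on_sub (Cg m) => y /HW[].
  - move=> y /HW [Oy [y0 H]]; have [_ [_ _ -> _] ->] := H (ltW y0) => //.
  - by move=> k; have [_ _ _ ->] := nbhs_singleton fg; rewrite cz.
split => [m|z k Az].
  apply: Ck_on_local => z /loc [ O [g [oO Oz Cg gf _]]].
  exists O; split => //; exact: eq_Ck_on (Cg m).
have [ O [g [oO Oz Cg gf gD]]] := loc z Az.
rewrite -gD; apply: near_eq_derive.
have nO : \forall y \near z, O y by exact: open_nbhs_nbhs.
by apply: filterS nO => y Oy; rewrite gf.
Qed.

(* A parallel section is determined by its restriction to an interior slice
   through the transport equation along the inner normal coordinate, whose
   coefficient is smooth up to the boundary. *)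
Lemma extend_parallel p W D s x : open W -> affine_connection W D -> W x ->
  mboundary M x ->
  (forall y, W y -> minterior M y -> dsmooth p s y /\ s y != 0) ->
  (forall y X, W y -> minterior M y -> vsmooth X y -> dens_deriv p D X s y = 0) ->
  exists V tau, [/\ open V, V x, V `<=` W, smooth_dens p V tau &
    forall y, V y -> tau y != 0 /\ (minterior M y -> s y = tau y)].
Proof.
move=> oW hD Wx bx ss sD; set i := chart_at x; have ix : cdom i x := chart_atP x.
set z0 := cto i x; have z00 : z0 0 ord0 = 0 by exact/(mboundaryE ix).
pose a y := p * ctrace D i (frame i ord0) y.
have sa : smooth_at a x.
  apply: smooth_at_mul; first exact: smooth_at_cst.
  by apply: (smooth_at_ctrace oW hD) => //; exact: vsmooth_frame.
(* As [D] is smooth up to the boundary, the transport coefficient has an extension [u] to a full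
   neighbourhood of [z0] in [E], on both sides of the hyperplane. *)
have [ O [u [oO Cu Oz au]]] := smooth_at_rep ix sa.
have nW : \forall y \near x, W y by exact: open_nbhs_nbhs.
have nO : \forall z \near z0, O z by exact: open_nbhs_nbhs.
have [B0 [oB0 B0z HB0]] := near_openP (filterI nO (near_cfrom ix (filterI nW au))).
have /nbhs_ballP [r /= r0 rB0] : nbhs z0 B0 by exact: open_nbhs_nbhs.
have rB z (Bz : ball z0 r z) := HB0 z (rB0 z Bz).
pose B := ball z0 r; pose Bp := B `&` [set z : E | 0 < z 0 ord0].
have BpP z : Bp z -> [/\ 0 < z 0 ord0, cdom i (cfrom i z), cto i (cfrom i z) = z,
    W (cfrom i z) /\ minterior M (cfrom i z) & a (cfrom i z) = u z].
  move=> [/rB [_ H] /= zp]; have [iz [Wz [_ _ auz _]] cz] := H (ltW zp); split => //.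
    by split => //; apply/(minteriorE iz); rewrite cz.
  by rewrite auz cz.
have ssi y : cdom i y -> W y -> minterior M y -> smooth_at (dens_in p i s) y.
  by move=> iy Wy /(ss y Wy) [/(dsmooth_in _ _ iy)].
pose f := dens_in p i s \o cfrom i.
have [Cf Df] : Cinf_on Bp f /\ forall z k, Bp z -> 'D_(e_ k) f z =
    pd i k (dens_in p i s) (cfrom i z).
  apply: Cinf_on_local_rep => z /BpP[zp iz cz [Wz mz] _]; split => //.
  exact: ssi.
have f0 z : Bp z -> f z != 0.
  move=> /BpP[zp iz cz [Wz mz] _]; apply: dens_in_neq0 => //.
  by have [] := ss _ Wz mz.
(* Parallelism along the normal frame field, once the nonzero transition factor of vol^p is divided
   out. *)
have Dfa z : Bp z -> 'D_(e_ ord0) f z = u z * f z.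
  move=> Bpz; rewrite Df //; have [zp iz cz [Wz mz] <-] := BpP z Bpz.
  set y := cfrom i z in iz cz Wz mz *.
  have [sy sy0] := ss y Wz mz.
  have := sD y _ Wz mz (vsmooth_frame ord0 iz).
  rewrite (dens_deriv_chart oW hD Wz iz (vsmooth_frame ord0 iz) sy).
  move=> /eqP; rewrite mulf_eq0 gt_eqF /=; last first.
    by rewrite powR_gt0 // normr_gt0 det_jac_neq0 //; exact: (chart_atP y).
  rewrite /dens_deriv_in subr_eq0.
  have E := vf_app_frame ord0 iz (ssi y iz Wz mz).
  by rewrite [X in X == _]E => /eqP H; exact: H.
have CuB : Cinf_on B u by move=> m; apply: Ck_on_sub (Cu m) => z /rB[].
have [g [Cg g0 gf]] := Cinf_extend z00 r0 CuB Cf f0 Dfa.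
have nB : \forall y \near x, B (cto i y).
  by apply: near_cto => //; apply: nbhsx_ballx.
have [V [oV Vx HV]] := near_openP (filterI nW (filterI nB (near_cdom ix))).
have q0 y : cdom i y -> `|\det (jac i (chart_at y) y)| `^ p != 0.
  move=> iy; rewrite gt_eqF // powR_gt0 // normr_gt0 det_jac_neq0 //.
  exact: (chart_atP y).
(* [g] gives the coefficient in chart [i]; the division converts it to the trivialisation of the
   chart at [y], and [dens_in p i] undoes it. *)
exists V, (fun y => g (cto i y) / `|\det (jac i (chart_at y) y)| `^ p); split => //.
- by move=> y /HV[].
- apply/smooth_densP => // y /HV [Wy [By iy]]; apply/(dsmooth_in _ _ iy).
  apply/(smooth_at_in _ iy); exists B, g; split => //; first exact: ball_open.
  by apply: filterS (near_cdom iy) => y' iy'; rewrite /dens_in divfK // q0.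
- move=> y /HV [Wy [By iy]]; split => [|my].
    by rewrite mulf_neq0 ?g0 // invr_neq0 // q0.
  rewrite gf; last by split => //; exact/(minteriorE iy).
  by rewrite /f /= ctoK // /dens_in mulfK // q0.
Qed.

Lemma form_app_dform X f x : form_app (dform f) X x = vf_app X f x.
Proof. by rewrite /form_app mxE; apply: eq_bigr => k _; rewrite mxE. Qed.

Lemma form_app_scale (c : M -> R) U X x :
  form_app (fun y => c y *: U y) X x = c x * form_app U X x.
Proof. by rewrite /form_app -scalemxAr mxE. Qed.

Lemma defining_fun_sub V V' rho : open V' -> V' `<=` V -> defining_fun V rho ->
  defining_fun V' rho.
Proof.
move=> oV' sub [oV srho rho0 rhob drho]; split => //.
- by apply/smooth_fun_at => // y /sub Vy; exact: (smooth_fun_at rho oV).1.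
- by move=> y /sub; exact: rho0.
- by move=> y /sub; exact: rhob.
- by move=> y /sub; exact: drho.
Qed.

Lemma defining_fun_gt0 V rho y : defining_fun V rho -> V y -> minterior M y -> 0 < rho y.
Proof.
move=> [_ _ rho0 rhob _] Vy my; rewrite lt_neqAle rho0 // andbT eq_sym.
by apply/eqP => /(rhob y Vy).
Qed.

(* With [c = p (n+2) / alpha] the derivative [c drho / rho] of the factor
   [rho ^ c] cancels the change [- p (n+2) drho / (alpha rho)] of the connection
   on vol^p, so [rho ^ c s] is parallel for [D'], which is smooth up to the
   boundary. *)
Lemma parallel_asymptotics alpha p W D D' rho s x : alpha != 0 ->
  affine_connection W D' ->
  conn_eq (W `&` minterior M) D'
    (conn_add D (fun y => (alpha * rho y)^-1 *: dform rho y)) ->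
  defining_fun W rho -> W x -> mboundary M x ->
  smooth_dens p (minterior M) s -> (forall y, minterior M y -> s y != 0) ->
  parallel_dens p (minterior M) D s ->
  exists V tau, [/\ V x, V `<=` W, defining_fun V rho, smooth_dens p V tau &
    forall y, V y -> tau y != 0 /\
      (minterior M y -> s y = rho y `^ (- (p * n.+2%:R / alpha)) * tau y)].
Proof.
move=> alpha0 hD' DD' drho Wx bx ss s0 ps.
have omi : open (minterior M) by exact: minterior_open.
have [oW srho _ _ _] := drho.
set c := p * n.+2%:R / alpha.
have rho_gt0 y : W y -> minterior M y -> 0 < rho y by exact: defining_fun_gt0 drho.
have srhoy y : W y -> smooth_at rho y by exact: (smooth_fun_at rho oW).1.
have ssy y : minterior M y -> dsmooth p s y by exact: (smooth_densP p s omi).1.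
pose s' y := rho y `^ c * s y.
have ss' y : W y -> minterior M y -> dsmooth p s' y /\ s' y != 0.
  move=> Wy my; split; last by rewrite mulf_neq0 ?s0 // gt_eqF // powR_gt0 // rho_gt0.
  by apply: dsmooth_mul; [apply: smooth_at_powR; [exact: rho_gt0|exact: srhoy]|exact: ssy].
have sD' y X : W y -> minterior M y -> vsmooth X y -> dens_deriv p D' X s' y = 0.
  move=> Wy my sX; have oWi : open (W `&` minterior M) by exact: openI.
  rewrite (dens_deriv_conn_eq p s' oWi DD' (conj Wy my) sX).
  have sp := smooth_at_powR c (rho_gt0 y Wy my) (srhoy y Wy).
  rewrite dens_deriv_conn_add (dens_deriv_mul _ _ sp (ssy y my)).
  rewrite ((parallel_densP p D s omi).1 ps y X my sX) mulr0 addr0.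
  rewrite form_app_scale form_app_dform (vf_app_powR _ _ (rho_gt0 y Wy my) (srhoy y Wy)).
  have r0 : rho y != 0 by rewrite gt_eqF // rho_gt0.
  rewrite powRB; last by rewrite r0 implybT.
  rewrite powRr1; last by rewrite ltW // rho_gt0.
  by rewrite /s' /c; field; rewrite alpha0 r0.
have [V [tau [oV Vx VW stau tauP]]] := extend_parallel oW hD' Wx bx ss' sD'.
exists V, tau; split => //; first exact: defining_fun_sub drho.
move=> y Vy; have [t0 st] := tauP y Vy; split => // my.
rewrite -st // /s' powRN mulKf // gt_eqF // powR_gt0 //.
by apply: rho_gt0 => //; exact: VW.
Qed.

Lemma fsmooth_scale (c : R) U x : fsmooth U x -> fsmooth (fun y => c *: U y) x.
Proof.
move=> sU k; apply: smooth_at_near (smooth_at_mul (smooth_at_cst c x) (sU k)).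
by apply: nearW => y; rewrite /form_in -scalemxAr [in RHS]mxE.
Qed.

Lemma fsmooth_cst0 x : fsmooth (fun=> 0) x.
Proof.
move=> k; apply: smooth_at_near (smooth_at_cst 0 x).
by apply: nearW => y; rewrite /form_in mulmx0 mxE.
Qed.

Lemma smooth_dens_opp p V s : open V -> smooth_dens p V s ->
  smooth_dens p V (fun y => - s y).
Proof.
move=> oV /smooth_densP H; apply/smooth_densP => // x Vx.
apply: smooth_at_near (smooth_at_opp (H oV x Vx)).
by apply: nearW => y; rewrite /dens_in mulNr.
Qed.

Lemma eweightM alpha : eweight n alpha * n.+2%:R = - alpha.
Proof. by rewrite /eweight divfK // pnatr_eq0. Qed.

Lemma projectively_compact_special alpha D : 0 < alpha ->
  special_connection (minterior M) D ->
  projectively_compact alpha D ->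
  volume_asymptotics (n.+2%:R / alpha) D.
Proof.
move=> a0 [nu [snu nu0 pnu]] pc x bx.
have [W [rho [Wx drho [D' hD' DD']]]] := pc x bx.
have [V [tau [Vx VW drho' stau tauP]]] :=
  parallel_asymptotics (lt0r_neq0 a0) hD' DD' drho Wx bx snu nu0 pnu.
have omi := @minterior_open R n M; have [oV _ _ _ _] := drho'.
exists V, rho, tau; split => //; first by move=> y /tauP[].
have oVi : open (V `&` minterior M) by exact: openI.
apply/parallel_densP => // y X [Vy my] sX.
have sy : dsmooth 1 nu y by exact: (smooth_densP 1 nu omi).1.
rewrite -(@dens_deriv_near _ _ _ 1 D X nu) //.
  exact: (parallel_densP 1 D nu omi).1.
have nVi : \forall y \near y, (V `&` minterior M) y by exact: open_nbhs_nbhs.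
apply: filterS nVi => z [Vz mz]; have [_ ->//] := tauP z Vz.
by rewrite mul1r.
Qed.

Lemma extend_by_0_interior s x : minterior M x -> extend_by_0 s x = s x.
Proof. by move=> mx; rewrite /extend_by_0 patchE mem_set. Qed.

Lemma extend_by_0_boundary s x : mboundary M x -> extend_by_0 s x = 0.
Proof. by move=> bx; rewrite /extend_by_0 patchE memNset. Qed.

Lemma projectively_compact_density alpha D s : 0 < alpha ->
  projectively_compact alpha D ->
  smooth_dens (eweight n alpha) (minterior M) s ->
  (forall x, minterior M x -> s x != 0) ->
  parallel_dens (eweight n alpha) (minterior M) D s ->
  defining_density (eweight n alpha) (extend_by_0 s).
Proof.
move=> a0 pc ss s0 ps; have omi := @minterior_open R n M.
have loc x : mboundary M x -> exists V tau rho, [/\ V x,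
    smooth_dens (eweight n alpha) V tau, forall y, V y -> tau y != 0,
    defining_fun V rho & forall y, V y -> extend_by_0 s y = rho y * tau y].
  move=> bx; have [W [rho [Wx drho [D' hD' DD']]]] := pc x bx.
  have [V [tau [Vx VW drho' stau tauP]]] :=
    parallel_asymptotics (lt0r_neq0 a0) hD' DD' drho Wx bx ss s0 ps.
  exists V, tau, rho; split => //; first by move=> y /tauP[].
  have [_ _ rho0 rhob _] := drho'.
  move=> y Vy; case: (pselect (mboundary M y)) => [bdy|my].
    by rewrite extend_by_0_boundary // (rhob y Vy).2 // mul0r.
  rewrite extend_by_0_interior //; have [_ ->//] := tauP y Vy.
  (* For the weight alpha, p (n+2) = - alpha, so the power of [rho] in front of [tau] is 1. *)
  by rewrite eweightM mulNr divff ?lt0r_neq0 // opprK powRr1 // rho0.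
split.
- apply/smooth_densP => [|x _]; first exact: openT.
  case: (pselect (mboundary M x)) => [bx|mx].
    have [V [tau [rho [Vx stau tau0 drho sE]]]] := loc x bx.
    have [oV srho _ _ _] := drho.
    have nV : \forall y \near x, V y by exact: open_nbhs_nbhs.
    apply: (@dsmooth_near _ _ _ _ (fun y => rho y * tau y)).
      by apply: filterS nV => y Vy; rewrite sE.
    apply: dsmooth_mul; first exact: (smooth_fun_at rho oV).1.
    exact: (smooth_densP _ tau oV).1.
  have nmi : \forall y \near x, minterior M y by exact: open_nbhs_nbhs.
  apply: (@dsmooth_near _ _ _ _ s).
    by apply: filterS nmi => y my; rewrite extend_by_0_interior.
  exact: (smooth_densP _ s omi).1.
- move=> x; split => [sx0|bx]; last exact: extend_by_0_boundary.
  case: (pselect (mboundary M x)) => // mx.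
  by move/eqP: sx0; rewrite extend_by_0_interior // (negPf (s0 x mx)).
- move=> x /loc [V [tau [rho [Vx stau tau0 drho sE]]]].
  by exists V, tau, rho; split => //; left.
Qed.

(** The same form [ups] is used twice: at [sigma] it gives the scale connection on the interior, at
    the nonvanishing [tau] the extension across the boundary. *)
Lemma defining_density_scale alpha P sigma : 0 < alpha ->
  @proj_structure _ _ M setT P -> defining_density (eweight n alpha) sigma ->
  exists D, [/\ scale_connection P alpha sigma D,
    forall D', scale_connection P alpha sigma D' -> conn_eq (minterior M) D D' &
    projectively_compact alpha D].
Proof.
move=> a0 [D0 hD0 ->] [ssig sig0 sigloc]; have omi := @minterior_open R n M.
have oT : open [set: M] by exact: openT.
set p := eweight n alpha.
have pE : p * n.+2%:R = - alpha by exact: eweightM.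
have an0 := lt0r_neq0 a0.
have sn0 x : minterior M x -> sigma x != 0 by move=> mx; apply/eqP => /sig0.
have ssx x : dsmooth p sigma x by exact: (smooth_densP p sigma oT).1.
pose L s X x := dens_deriv p D0 X s x.
pose ups s : Defs.form M := fun x => - alpha^-1 *: logform p D0 s x.
have upsE s X x : dsmooth p s x -> vsmooth X x ->
    form_app (ups s) X x = - alpha^-1 * ((s x)^-1 * L s X x).
  move=> sx sX; rewrite (form_app_scale (fun=> - alpha^-1)).
  by rewrite (form_app_logform oT hD0).
have ups_smooth V s : open V -> smooth_dens p V s -> (forall x, V x -> s x != 0) ->
    smooth_form V (ups s).
  move=> oV sV s0; apply/smooth_formP => // x Vx; apply: fsmooth_scale.
  by apply: (fsmooth_logform oT hD0) => //; [exact: (smooth_densP p s oV).1|exact: s0].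
have hD0V V : affine_connection V D0 by exact: affine_connection_sub hD0.
pose D := conn_add D0 (ups sigma).
have sups : smooth_form (minterior M) (ups sigma).
  by apply: ups_smooth => //; apply/smooth_densP.
have hD : affine_connection (minterior M) D by exact: conn_add_affine.
exists D; split.
- split.
    (* [D0] belongs to its own class through the zero form, and reaches [D] through [ups sigma] on
       the interior. *)
    split => //; exists D0; last by exists (ups sigma).
    split => //; exists (fun=> 0).
      by apply/smooth_formP => // x _; exact: fsmooth_cst0.
    move=> V X Y oV _ _ _ x _.
    by rewrite /conn_add /form_app !mulmx0 !mxE !scale0r !addr0.
  apply/parallel_densP => // x X mx sX.
  rewrite dens_deriv_conn_add pE upsE // -/(L sigma X x).
  by field; rewrite an0 sn0.
- move=> D' [[hD' [D1 [hD1 [U0 sU0 D01]] [U1 sU1 D1']]] pD'] V X Y oV VW sX sY x Vx.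
  have mx := VW x Vx.
  (* Uniqueness: [D'] differs from [D0] by the total form U0 + U1, and parallelism of the nonzero
     [sigma] determines it because alpha is nonzero. *)
  have key Z : vsmooth Z x -> form_app U0 Z x + form_app U1 Z x = form_app (ups sigma) Z x.
    move=> sZ; have := (parallel_densP p D' sigma omi).1 pD' x Z mx sZ.
    rewrite (dens_deriv_conn_eq p sigma omi D1' mx sZ) dens_deriv_conn_add.
    rewrite (dens_deriv_conn_eq p sigma oT D01 _ sZ) // dens_deriv_conn_add.
    rewrite pE upsE // -/(L sigma Z x) => LE.
    have {LE} -> : L sigma Z x = - alpha * (form_app U0 Z x + form_app U1 Z x) * sigma x.
      by apply/eqP; rewrite -subr_eq0 -LE; apply/eqP; ring.
    by field; rewrite an0 sn0.
  have sXx := (smooth_vfP X oV).1 sX x Vx; have sYx := (smooth_vfP Y oV).1 sY x Vx.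
  rewrite (D1' V) // /conn_add (D01 V) // /D /conn_add -!key //.
  by rewrite !scalerDl -!addrA; congr (_ + (_ + _)); rewrite addrCA.
move=> x bx; have [V [tau0 [rho [Vx stau0 tau00 drho sE0]]]] := sigloc x bx.
have [oV srho rho0 rhob _] := drho.
(* The sign allowed in a defining density is absorbed into the trivialising section. *)
have [tau [stau taun0 sE]] : exists tau, [/\ smooth_dens p V tau,
    forall y, V y -> tau y != 0 & forall y, V y -> sigma y = rho y * tau y].
  case: sE0 => sE; first by exists tau0.
  exists (fun y => - tau0 y); split; first exact: smooth_dens_opp.
    by move=> y /tau00; rewrite oppr_eq0.
  by move=> y Vy; rewrite sE // mulrN mulNr.
exists V, rho; split => //; exists (conn_add D0 (ups tau)).
  by apply: conn_add_affine => //; exact: ups_smooth.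
move=> V' X Y oV' sub sX sY y V'y; have [Vy my] := sub y V'y.
(* The logarithmic derivative of rho tau is drho / rho plus that of tau; multiply by -1/alpha. *)
have key Z : vsmooth Z y -> form_app (ups tau) Z y = form_app (ups sigma) Z y +
    form_app (fun y => (alpha * rho y)^-1 *: dform rho y) Z y.
  move=> sZ; have st : dsmooth p tau y by exact: (smooth_densP p tau oV).1.
  have sr : smooth_at rho y by exact: (smooth_fun_at rho oV).1.
  rewrite !upsE // form_app_scale form_app_dform.
  have nV : \forall z \near y, V z by exact: open_nbhs_nbhs.
  have -> : L sigma Z y = vf_app Z rho y * tau y + rho y * L tau Z y.
    rewrite -(dens_deriv_mul _ _ sr st); apply: dens_deriv_near => //.
    by apply: filterS nV => z Vz; rewrite sE.
  have r0 : rho y != 0 by rewrite gt_eqF // (defining_fun_gt0 drho).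
  by rewrite (sE y Vy); field; rewrite an0 r0 taun0.
have sXx := (smooth_vfP X oV').1 sX y V'y; have sYx := (smooth_vfP Y oV').1 sY y V'y.
rewrite /D /conn_add !key //.
by rewrite !scalerDl -!addrA; congr (_ + (_ + _)); rewrite addrCA.
Qed.

End ProjectiveCompactness.

Theorem proposition2p3 (R : realType) (n : nat) (M : bmanifold R n)
    (alpha : R) (alpha_gt0 : 0 < alpha) :
  (forall D : vfield M -> vfield M -> vfield M,
     affine_connection (minterior M) D ->
     special_connection (minterior M) D ->
     projectively_compact alpha D ->
     volume_asymptotics (n.+2%:R / alpha) D /\
     (forall s : density M,
        smooth_dens (eweight n alpha) (minterior M) s ->
        (forall x, minterior M x -> s x != 0) ->
        parallel_dens (eweight n alpha) (minterior M) D s ->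
        defining_density (eweight n alpha) (extend_by_0 s))) /\
  (forall (P : set (vfield M -> vfield M -> vfield M)) (sigma : density M),
     proj_structure setT P ->
     defining_density (eweight n alpha) sigma ->
     (forall x, minterior M x -> sigma x != 0) /\
     exists D : vfield M -> vfield M -> vfield M,
       [/\ scale_connection P alpha sigma D,
           forall D', scale_connection P alpha sigma D' ->
             conn_eq (minterior M) D D' &
           projectively_compact alpha D]).
Proof.
split=> [D hD special pc|P sigma hP hsigma]; split.
- exact: projectively_compact_special.
- by move=> s; exact: projectively_compact_density.
- by have [_ sig0 _] := hsigma; move=> x mx; apply/eqP => /sig0.
- exact: defining_density_scale.
Qed.
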